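(* Let $B$ be an affine (finitely generated) commutative domain over $\mathsf{k}$ (not necessarily regular) with $n=\operatorname{trdeg}_{\mathsf{k}} B$. Then the ring of differential operators $D(B)$ is $LD$-stable and $LD\, D(B)=2n$.
   Context: $\mathsf{k}$ is a field of characteristic zero; all algebras are $\mathsf{k}$-algebras. For a commutative $\mathsf{k}$-algebra $A$, set $D(A)_0=A$ (acting by multiplication), $D(A)_m=\{d\in \operatorname{End}_{\mathsf{k}}A : [d,a]\in D(A)_{m-1}\ \forall a\in A\}$, and $D(A)=\bigcup_m D(A)_m$. A subframe of an algebra $A$ is a finite-dimensional subspace containing $1$. Gelfand–Kirillov dimension: $GK\,A=\sup_V\limsup_{m\to\infty}\log(\dim V^m)/\log m$ over subframes $V$. Lower transcendence degree: if for every subframe $V$ there is a finite-dimensional nonzero subspace $W\subset A$ with $\dim VW=\dim W$, then $LD\,A=0$. Otherwise, for real $d>0$, a subframe $V$ satisfies $VDI(A)_d$ if there is $c>0$ with $\dim VW\ge \dim W+c(\dim W)^{(d-1)/d}$ for all finite-dimensional nonzero $W$, and $LD\,A=\sup_V\sup\{d: VDI(A)_d \text{ holds for } V\}$. An algebra $A$ is $LD$-stable if $LD\,A=GK\,A$. *)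

(* Defs.v *)
From HB Require Import structures.
From mathcomp Require Import all_boot all_order all_algebra.
From mathcomp Require Import all_classical all_reals all_analysis.
Set Implicit Arguments. Unset Strict Implicit. Unset Printing Implicit Defensive.
Import Order.TTheory GRing.Theory Num.Theory.
Local Open Scope ring_scope.
Local Open Scope classical_set_scope.

Definition lin_indep (k : fieldType) (E : lmodType k) (s : seq E) : Prop :=
  forall c : 'I_(size s) -> k,
    \sum_(i < size s) c i *: s`_i = 0 -> forall i, c i = 0.

Definition span (k : fieldType) (E : lmodType k) (s : seq E) : set E :=
  [set v | exists c : 'I_(size s) -> k, v = \sum_(i < size s) c i *: s`_i].

(** dimension of [span s]: the largest size of a linearly independent family
    inside [span s] (such a family never has more than [size s] elements). *)
Definition dimspan (k : fieldType) (E : lmodType k) (s : seq E) : nat :=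
  \max_(d < (size s).+1 |
        `[< exists t : seq E,
              [/\ size t = d, lin_indep t & forall v, v \in t -> span s v] >]) d.

(** * Products of subspaces in an algebra whose multiplication is [mul]
    (finite-dimensional subspaces are represented by finite spanning families) *)

Definition seqprod (T : Type) (mul : T -> T -> T) (s t : seq T) : seq T :=
  [seq mul x y | x <- s, y <- t].

Fixpoint seqpow (T : Type) (mul : T -> T -> T) (one : T) (s : seq T) (m : nat)
  : seq T :=
  match m with
  | 0 => [:: one]
  | m'.+1 => seqprod mul (seqpow mul one s m') s
  end.

Definition in_alg (T : eqType) (A : set T) (s : seq T) : Prop :=
  forall v, v \in s -> A v.

Definition subframe (k : fieldType) (E : lmodType k) (one : E) (A : set E)
  (s : seq E) : Prop :=
  in_alg A s /\ span s one.

Definition GKdim (R : realType) (k : fieldType) (E : lmodType k)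
  (mul : E -> E -> E) (one : E) (A : set E) : \bar R :=
  ereal_sup [set limn_esup (fun m : nat =>
                 ((ln (dimspan (seqpow mul one s m))%:R / ln (m%:R : R))%:E))
            | s in [set s | subframe one A s]].

Definition VDI (R : realType) (k : fieldType) (E : lmodType k)
  (mul : E -> E -> E) (A : set E) (s : seq E) (d : R) : Prop :=
  exists c : R, 0 < c /\
    forall w : seq E, in_alg A w -> (0 < dimspan w)%N ->
      (dimspan w)%:R + c * ((dimspan w)%:R `^ ((d - 1) / d))
        <= ((dimspan (seqprod mul s w))%:R : R).

Definition LDdim (R : realType) (k : fieldType) (E : lmodType k)
  (mul : E -> E -> E) (one : E) (A : set E) : \bar R :=
  if `[< forall s, subframe one A s ->
           exists w, [/\ in_alg A w, (0 < dimspan w)%N &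
                         dimspan (seqprod mul s w) = dimspan w] >]
  then 0%E
  else ereal_sup [set d%:E | d in
                   [set d : R | 0 < d /\
                      exists s, subframe one A s /\ VDI mul A s d]].

Definition mulop (k : fieldType) (B : comAlgType k) (a : B) : B -> B :=
  fun x => a * x.

Definition klinear (k : fieldType) (B : comAlgType k) (d : B -> B) : Prop :=
  forall (c : k) (x y : B), d (c *: x + y) = c *: d x + d y.

Fixpoint diffop (k : fieldType) (B : comAlgType k) (m : nat) : set (B -> B) :=
  match m with
  | 0 => [set f | exists a : B, f = mulop a]
  | m'.+1 => [set d | klinear d /\
                forall a : B, diffop m' ((d \o mulop a) - (mulop a \o d))]
  end.

Definition DiffOps (k : fieldType) (B : comAlgType k) : set (B -> B) :=
  [set d | exists m, diffop m d].

Definition endo_comp (T : Type) (f g : T -> T) : T -> T := f \o g.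

Definition GK_D (R : realType) (k : fieldType) (B : comAlgType k) : \bar R :=
  GKdim R (fun f g : B -> B => endo_comp f g) idfun (@DiffOps _ B).
Definition LD_D (R : realType) (k : fieldType) (B : comAlgType k) : \bar R :=
  LDdim R (fun f g : B -> B => endo_comp f g) idfun (@DiffOps _ B).

Definition is_domain (k : fieldType) (B : comAlgType k) : Prop :=
  forall x y : B, x * y = 0 -> x = 0 \/ y = 0.

Inductive gen_by (k : fieldType) (B : comAlgType k) (s : seq B) : B -> Prop :=
  | gen_in x : x \in s -> gen_by s x
  | gen_one : gen_by s 1
  | gen_add x y : gen_by s x -> gen_by s y -> gen_by s (x + y)
  | gen_mul x y : gen_by s x -> gen_by s y -> gen_by s (x * y)
  | gen_scale (c : k) x : gen_by s x -> gen_by s (c *: x).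

Definition finitely_generated (k : fieldType) (B : comAlgType k) : Prop :=
  exists s : seq B, forall b : B, gen_by s b.

Definition alg_indep (k : fieldType) (B : comAlgType k) (n : nat) (x : 'I_n -> B)
  : Prop :=
  forall (S : seq {ffun 'I_n -> nat}) (c : {ffun 'I_n -> nat} -> k),
    uniq S ->
    \sum_(m <- S) c m *: \prod_(i < n) x i ^+ m i = 0 ->
    forall m, m \in S -> c m = 0.

(** trdeg_k B = n (for a domain: maximal number of algebraically
    independent elements, = trdeg of its fraction field) *)
Definition trdeg_eq (k : fieldType) (B : comAlgType k) (n : nat) : Prop :=
  (exists x : 'I_n -> B, alg_indep x) /\
  (forall (m : nat) (x : 'I_m -> B), alg_indep x -> (m <= n)%N).

(* Main.v *)
(** Let [x_1, ..., x_n] be a transcendence basis of [B].  An operator [d] of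
    [D(B)] is encoded by its symbols [ad(x)^al(d)(1)], [al] in [N^n], which are
    the coefficients of [d] in the derivations dual to the [x_i], up to [al!]
    and a sign.  They determine [d], because an operator commuting with every
    [x_i] commutes with all of [B] up to a derivation killing [k[x]], hence
    killing [B] (characteristic zero, [B] algebraic over [k[x]]).

    Upper bound: an operator raises the degree filtration of [B] by a bounded
    amount, and after multiplication by a power of one element this filtration
    lies in a finite [k[x]]-module, so the symbols of the elements of [V^m]
    range over [O(m^n)] multi-indices with values in a space of dimension
    [O(m^n)].

    Lower bound: some [g <> 0] makes the [g d/dx_i] derivations of [B].  Take
    for [V] the span of [1], the [x_i] and these derivations.  Given [W], the
    lexicographically leading terms of the symbols, expanded over a
    [k[x]]-independent family after clearing denominators, are shifted by each
    of the [2n] generators along its own coordinate, so [dim VW - dim W] is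
    bounded below by the discrete isoperimetric inequality in [N^(2n)].

    Finally [dim VW >= dim W + c (dim W)^((d-1)/d)] along [W = V^m] forces
    [dim V^m] to grow at least like [m^d], whence [LD <= GK]. *)
Require Import Defs.
From HB Require Import structures.
From mathcomp Require Import all_boot all_order all_algebra.
From mathcomp Require Import all_classical all_reals all_analysis.
From mathcomp Require Import ring zify.
Set Implicit Arguments. Unset Strict Implicit. Unset Printing Implicit Defensive.
Import Order.TTheory GRing.Theory Num.Theory.
Local Open Scope ring_scope.

(** * Spans and independence *)

Section LinearAlgebra.
Variable k : fieldType.
Implicit Types E F : lmodType k.

(** When [B] is not regular, [D(B)] need not be generated by [B] and derivations, nor be noetherian,
    so neither bound can be read off from generators or from an associated graded ring. Symbols
    exist for every operator, and only finitely many operators are compared at a time. No fraction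
    field is formed: a division is replaced by multiplication by a nonzero element, which can be
    cancelled because [B] is a domain. In the lower bound the order bound, the denominator and the
    independent family depend on [W]; this does no harm, because the final inequality compares only
    numbers of index lists, and its constant is 1 for every [W]. Powers of [g] enter there because a
    dual derivation multiplies a leading coefficient by [g], which could move its leading monomial.
    The exponent 2n counts the shifted coordinates, n orders and n degrees; the position in the
    independent family is one more coordinate, which no generator shifts. For n = 0 the
    isoperimetric bound is void, and [LD] vanishes because the dimensions of the powers of a
    subframe stabilize. *)

Inductive lspan E (P : set E) : E -> Prop :=
  | lspan0 : lspan P 0
  | lspan_cons c x v : P x -> lspan P v -> lspan P (c *: x + v).

Lemma lspan_in E (P : set E) x : P x -> lspan P x.
Proof. by move=> Px; rewrite -[x]addr0 -[x]scale1r; apply: lspan_cons => //; apply: lspan0. Qed.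

Lemma lspanD E (P : set E) u v : lspan P u -> lspan P v -> lspan P (u + v).
Proof.
by move=> Hu Hv; elim: Hu => [|c x w Px _ IH]; rewrite ?add0r // -addrA; apply: lspan_cons.
Qed.

Lemma lspanZ E (P : set E) a u : lspan P u -> lspan P (a *: u).
Proof.
elim=> [|c x w Px _ IH]; rewrite ?scaler0; first exact: lspan0.
by rewrite scalerDr scalerA; apply: lspan_cons.
Qed.

Lemma lspanB E (P : set E) u v : lspan P u -> lspan P v -> lspan P (u - v).
Proof. by move=> Hu Hv; apply: lspanD => //; rewrite -scaleN1r; apply: lspanZ. Qed.

Lemma lspan_sum E (P : set E) (I : Type) (r : seq I) (Q : pred I) (f : I -> E) :
  (forall i, Q i -> lspan P (f i)) -> lspan P (\sum_(i <- r | Q i) f i).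
Proof. by move=> H; apply: big_ind => //; [exact: lspan0 | exact: lspanD]. Qed.

Lemma lspan_bind E F (P : set E) (Q : set F) (f : E -> F) :
  (forall c u v, f (c *: u + v) = c *: f u + f v) ->
  (forall x, P x -> lspan Q (f x)) -> forall v, lspan P v -> lspan Q (f v).
Proof.
move=> fL H v; elim=> [|c x w Px _ IH].
  have := fL (-1) 0 0; rewrite scaler0 addr0 scaleN1r addNr => ->; exact: lspan0.
by rewrite fL; apply: lspanD => //; apply: lspanZ; apply: H.
Qed.

Lemma lspan_sub E (P Q : set E) :
  (forall x, P x -> lspan Q x) -> forall v, lspan P v -> lspan Q v.
Proof. by move=> H v; apply: (lspan_bind (f := id)). Qed.

Lemma spanE E (s : seq E) v : Defs.span s v <-> lspan (fun x => x \in s) v.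
Proof.
split=> [[c ->]|].
  by apply: lspan_sum => i _; apply: lspanZ; apply: lspan_in; rewrite mem_nth.
elim=> [|c x w xs _ [d ->]].
  by exists (fun _ => 0); rewrite big1 // => i _; rewrite scale0r.
have xi : (index x s < size s)%N by rewrite index_mem.
exists (fun i => (i == Ordinal xi)%:R * c + d i).
under [RHS]eq_bigr => i _ do rewrite scalerDl.
rewrite big_split /=; congr (_ + _).
rewrite (bigD1 (Ordinal xi)) //= eqxx mul1r nth_index // big1 ?addr0 //.
by move=> i /negbTE ->; rewrite mul0r scale0r.
Qed.

Lemma span_in E (s : seq E) v : v \in s -> Defs.span s v.
Proof. by move=> vs; apply/spanE/lspan_in. Qed.

Lemma nonzero_kernel (J : finType) (d : nat) (M : 'I_d -> J -> k) :
  (#|J| < d)%N ->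
  exists c : 'I_d -> k, (exists i, c i != 0) /\ forall j, \sum_i c i * M i j = 0.
Proof.
move=> Jd; pose A : 'M[k]_(d, #|J|) := \matrix_(i, j) M i (enum_val j).
have : kermx A != 0.
  by rewrite -mxrank_eq0 mxrank_ker -lt0n subn_gt0 (leq_ltn_trans (rank_leq_col A)).
case/rowV0Pn=> v /sub_kermxP vA v0.
exists (fun i => v 0 i); split.
  apply/existsP; apply: contraNT v0; rewrite negb_exists => /forallP H.
  by apply/eqP/rowP => i; rewrite mxE; apply/eqP; move: (H i); rewrite negbK.
move=> j; have /rowP/(_ (enum_rank j)) := vA; rewrite !mxE => E0.
by rewrite -[RHS]E0; apply: eq_bigr => i _; rewrite mxE enum_rankK.
Qed.

(** The coordinates of all [psi a] on [t] form a matrix with [#|A| * size g] columns. With more rows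
    than columns, a nonzero combination of [t] would be killed by every [psi a], against joint
    injectivity. Operators are counted this way through their symbols, with [A] a set of
    multi-indices. *)
Lemma lin_indep_size_le E F (A : finType) (psi : A -> E -> F) (g : seq F) (t : seq E) :
  (forall a c u v, psi a (c *: u + v) = c *: psi a u + psi a v) ->
  lin_indep t ->
  (forall v, Defs.span t v -> (forall a, psi a v = 0) -> v = 0) ->
  (forall a v, v \in t -> Defs.span g (psi a v)) ->
  (size t <= #|A| * size g)%N.
Proof.
move=> psiL tI inj img; rewrite leqNgt; apply/negP => lt.
have psi_sum a (c : 'I_(size t) -> k) :
    psi a (\sum_i c i *: t`_i) = \sum_i c i *: psi a t`_i.
  have psi0 : psi a 0 = 0.
    by have := psiL a (-1) 0 0; rewrite scaler0 addr0 scaleN1r addNr.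
  elim/big_rec2: _ => // i u v _ <-; exact: psiL.
have /choice[M HM] : forall z : 'I_(size t) * A, exists m : 'I_(size g) -> k,
    psi z.2 t`_z.1 = \sum_i m i *: g`_i.
  by move=> [i a]; apply: img; rewrite mem_nth.
have [] := @nonzero_kernel (A * 'I_(size g))%type (size t) (fun i z => M (i, z.1) z.2).
  by rewrite card_prod card_ord.
move=> c [[i ci] Hc]; case/negP: ci; apply/eqP; apply: tI i.
apply: inj; first by exists c.
move=> a; rewrite psi_sum.
under eq_bigr => i _ do rewrite (HM (i, a)) scaler_sumr.
rewrite exchange_big big1 //= => j _.
under eq_bigr => i _ do rewrite scalerA.
by rewrite -scaler_suml (Hc (a, j)) scale0r.
Qed.

Lemma lin_indep_le E (s t : seq E) :
  lin_indep t -> (forall v, v \in t -> Defs.span s v) -> (size t <= size s)%N.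
Proof.
move=> tI ts; rewrite -[size s]mul1n -card_unit.
apply: (@lin_indep_size_le _ _ _ (fun _ => id)) => //.
by move=> v _ /(_ tt).
Qed.

Lemma dimspan_ge E (s t : seq E) :
  lin_indep t -> (forall v, v \in t -> Defs.span s v) -> (size t <= dimspan s)%N.
Proof.
move=> tI ts; have lt : (size t < (size s).+1)%N by rewrite ltnS lin_indep_le.
rewrite /dimspan; apply: (@leq_bigmax_cond _ _ (fun d : 'I__ => d : nat) (Ordinal lt)).
by apply/asboolP; exists t.
Qed.

Lemma dimspan_ex E (s : seq E) :
  exists t, [/\ size t = dimspan s, lin_indep t & forall v, v \in t -> Defs.span s v].
Proof.
pose P (d : 'I_(size s).+1) := `[< exists t : seq E,
  [/\ size t = d, lin_indep t & forall v, v \in t -> Defs.span s v] >].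
have : (0 < #|P|)%N.
  apply/card_gt0P; exists ord0; apply/asboolP; exists [::]; split=> //.
  by move=> c _ [].
by case/(eq_bigmax_cond (fun d : 'I__ => d : nat)) => d /asboolP Pd E1; rewrite /dimspan E1.
Qed.

Lemma dimspan_leP E (s : seq E) N :
  (forall t, lin_indep t -> (forall v, v \in t -> Defs.span s v) -> (size t <= N)%N) ->
  (dimspan s <= N)%N.
Proof. by move=> H; have [t [<- tI ts]] := dimspan_ex s; apply: H. Qed.

Lemma dimspan_mono E (s s' : seq E) :
  (forall v, v \in s -> Defs.span s' v) -> (dimspan s <= dimspan s')%N.
Proof.
move=> ss; have [t [<- tI ts]] := dimspan_ex s; apply: dimspan_ge => // v /ts /spanE sv.
by apply/spanE; apply: lspan_sub sv => x /ss /spanE.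
Qed.

Lemma dimspan_gt0 E (s : seq E) v : Defs.span s v -> v != 0 -> (0 < dimspan s)%N.
Proof.
move=> sv v0; apply: (@dimspan_ge _ s [:: v]); last by move=> w; rewrite inE => /eqP ->.
move=> c; rewrite big_ord1 /= => /eqP; rewrite scaler_eq0 (negbTE v0) orbF => /eqP c0 i.
by rewrite ord1.
Qed.

(** [lin_indep] concerns one finite sequence, whereas monomials are indexed by infinitely many
    exponent lists; relations are therefore tested on finite duplicate-free lists of indices. *)
Definition indep_on (I : eqType) E (e : I -> E) (P : set I) : Prop :=
  forall (J : seq I) (c : I -> k), uniq J -> (forall i, i \in J -> P i) ->
    \sum_(i <- J) c i *: e i = 0 -> forall i, i \in J -> c i = 0.

Lemma lin_indep_map (I : eqType) E (e : I -> E) (J : seq I) :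
  uniq J -> indep_on e (fun i => i \in J) -> lin_indep (map e J).
Proof.
case: J => [_ _ c _ []//|i0 J']; set J := i0 :: J' => UJ HJ c Hc i.
have iJ (j : 'I_(size (map e J))) : (j < size J)%N by rewrite -(size_map e) ltn_ord.
pose c' a := c (inord (index a J)).
have Ec (j : 'I_(size (map e J))) : c' (nth i0 J j) = c j.
  by rewrite /c' index_uniq //; congr c; apply: val_inj; rewrite /= inordK ?size_map.
rewrite -Ec; apply: (HJ J) => //; last by rewrite mem_nth.
rewrite -[RHS]Hc (big_nth i0) -(size_map e J) big_mkord; apply: eq_bigr => j _.
by rewrite Ec (nth_map i0).
Qed.

Lemma lin_indep_on E (t : seq E) :
  lin_indep t -> indep_on (fun i => t`_i) (fun i => (i < size t)%N).
Proof.
move=> tI J c UJ JP H i iJ.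
have it := JP _ iJ.
have := tI (fun i => if (i : nat) \in J then c i else 0) _ (Ordinal it).
rewrite /= iJ; apply; rewrite -[RHS]H.
under eq_bigr => j _ do rewrite (fun_if (fun z => z *: t`_j)) scale0r.
rewrite -big_mkcond /= -(big_mkord (fun j => j \in J) (fun j => c j *: t`_j)).
rewrite -big_filter; apply: perm_big; apply: uniq_perm => //.
  by rewrite filter_uniq // iota_uniq.
move=> j; rewrite mem_filter mem_index_iota /=.
by case jJ: (j \in J); rewrite //= (JP _ jJ).
Qed.

Lemma lspan_finite (I : eqType) E (e : I -> E) (P : set I) v :
  lspan (fun x => exists2 i, P i & x = e i) v ->
  exists J c, [/\ uniq J, forall i, i \in J -> P i & v = \sum_(i <- J) c i *: e i].
Proof.
elim=> [|a x w [i Pi ->] _ [J [c [UJ JP ->]]]].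
  by exists [::], (fun _ => 0); rewrite big_nil.
pose c' j := (j == i)%:R * a + (j \in J)%:R * c j.
exists (if i \in J then J else i :: J), c'; split.
- by case: ifP => //= ->.
- by case: ifP => [_ //|_] j; rewrite inE => /orP[/eqP -> //|]; apply: JP.
have Hw (K : seq I) : uniq K -> {subset J <= K} ->
    \sum_(j <- K) ((j \in J)%:R * c j) *: e j = \sum_(j <- J) c j *: e j.
  move=> UK JK; rewrite (bigID (fun j => j \in J)) /= [X in _ + X]big1 ?addr0.
    rewrite -big_filter -(@perm_big _ _ _ _ J).
      by apply: eq_big_seq => j ->; rewrite mul1r.
    apply: uniq_perm => //; first by rewrite filter_uniq.
    by move=> j; rewrite mem_filter; case jJ: (j \in J); rewrite //= JK.
  by move=> j /negbTE ->; rewrite mul0r scale0r.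
have Hi (K : seq I) : uniq K -> i \in K -> \sum_(j <- K) ((j == i)%:R * a) *: e j = a *: e i.
  move=> UK iK; rewrite (bigD1_seq i) //= eqxx mul1r big1 ?addr0 // => j /negbTE ->.
  by rewrite mul0r scale0r.
under [RHS]eq_bigr => j _ do rewrite scalerDl.
rewrite big_split /= Hw ?Hi //; case: ifP => //= iJ; rewrite ?iJ ?inE ?eqxx //.
by move=> j jJ; rewrite inE jJ orbT.
Qed.

Lemma indep_lspan_disjoint (I : eqType) E (e : I -> E) (P Q Q' : set I) v :
  indep_on e P -> (forall i, Q i -> P i) -> (forall i, Q' i -> P i) ->
  (forall i, Q i -> ~ Q' i) ->
  lspan (fun x => exists2 i, Q i & x = e i) v ->
  lspan (fun x => exists2 i, Q' i & x = e i) v -> v = 0.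
Proof.
move=> eI QP QP' QQ /lspan_finite[J [c [UJ JQ Ev]]] /lspan_finite[K [d [UK KQ Ev']]].
pose c' i := if i \in J then c i else - d i.
have notJ i : i \in K -> i \in J = false.
  by move=> /KQ Ki; apply/negP => /JQ Ji; apply: (QQ i).
have EJ : \sum_(i <- J) c' i *: e i = v.
  by rewrite Ev; apply: eq_big_seq => i iJ; rewrite /c' iJ.
have EK : \sum_(i <- K) c' i *: e i = - v.
  by rewrite Ev' -sumrN; apply: eq_big_seq => i iK; rewrite /c' notJ // scaleNr.
have H := @eI (J ++ K) c' _ _ _.
rewrite -EJ big_seq big1 // => i iJ; rewrite H ?scale0r ?mem_cat ?iJ //.
- rewrite cat_uniq UJ UK andbT; apply/hasPn => j /= jK; by rewrite notJ.
- by move=> j; rewrite mem_cat => /orP[/JQ/QP|/KQ/QP'].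
by rewrite big_cat /= EJ EK subrr.
Qed.

End LinearAlgebra.

(** * A discrete isoperimetric inequality *)

(** Over the reals one would sum a_t <= M^(1/d) D_t. To stay in the natural numbers, both d-th
    powers are expanded over the functions from d to I, and the resulting products are compared
    through their own d-th powers. *)
Lemma sum_pow_le (I : finType) (d M : nat) (a D : I -> nat) :
  (0 < d)%N -> (forall t, (a t ^ d <= M * D t ^ d)%N) ->
  ((\sum_t a t) ^ d <= M * (\sum_t D t) ^ d)%N.
Proof.
move=> d0 H.
have E (F : I -> nat) : ((\sum_t F t) ^ d = \sum_(f : {ffun 'I_d -> I}) \prod_i F (f i))%N.
  rewrite -(bigA_distr_bigA (fun _ => F)) -[d in LHS]card_ord -prod_nat_const.
  exact: eq_bigr.
rewrite !E big_distrr /=; apply: leq_sum => f _.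
have P (G : 'I_d -> nat) : ((\prod_i G i) ^ d = \prod_i G i ^ d)%N.
  exact: (big_morph (fun x => x ^ d)%N (fun x y => expnMn x y d) (exp1n d)).
rewrite -(leq_exp2r _ _ d0) expnMn !P.
have -> : (M ^ d = \prod_(i < d) M)%N by rewrite prod_nat_const card_ord.
by rewrite -big_split /=; apply: leq_prod => i _; apply: H.
Qed.

Lemma telescope_le (a D : nat -> nat) (t r : nat) :
  (forall t, (a t <= a t.+1 + D t.+1)%N) ->
  (a t <= a (t + r) + \sum_(t.+1 <= i < (t + r).+1) D i)%N.
Proof.
move=> H; elim: r => [|r IH]; first by rewrite addn0 big_geq // addn0.
apply: (leq_trans IH); rewrite addnS [in leqRHS]big_nat_recr /=; last by rewrite ltnS leq_addr.
by rewrite addnA addnAC leq_add2r; apply: H.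
Qed.

Definition slice (t : nat) (S : seq (seq nat)) : seq (seq nat) :=
  [seq behead s | s <- S & head 0%N s == t].

Lemma mem_slice (p t : nat) (s : seq nat) (S : seq (seq nat)) :
  (forall z, z \in S -> size z = p.+1) -> (s \in slice t S) = (t :: s \in S).
Proof.
move=> HS; apply/mapP/idP => [[z]|Hs].
  rewrite mem_filter => /andP[/eqP ht zS] ->; have := HS _ zS.
  by case: z ht zS => //= h z -> zS _.
by exists (t :: s) => //; rewrite mem_filter /= eqxx.
Qed.

Lemma uniq_slice (p t : nat) (S : seq (seq nat)) :
  (forall z, z \in S -> size z = p.+1) -> uniq S -> uniq (slice t S).
Proof.
move=> HS US; rewrite map_inj_in_uniq ?filter_uniq // => y z.
rewrite !mem_filter => /andP[/eqP hy yS] /andP[/eqP hz zS].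
have := HS _ yS; have := HS _ zS.
by case: y hy yS => //= ? ? -> _; case: z hz zS => //= ? ? -> _ _ _ ->.
Qed.

Lemma size_slices (L : nat) (S : seq (seq nat)) :
  (forall z, z \in S -> (head 0%N z < L)%N) ->
  size S = (\sum_(t < L) size (slice t S))%N.
Proof.
move=> H; under eq_bigr => t _ do rewrite size_map size_filter.
elim: S H => [|s S IH] H /=; first by rewrite big1.
rewrite big_split /= -IH; last by move=> z zS; apply: H; rewrite inE zS orbT.
have hs : (head 0%N s < L)%N by apply: H; rewrite inE eqxx.
rewrite (bigD1 (Ordinal hs)) //= eqxx big1 // => i Hi.
by case: eqP => // E; case/negP: Hi; apply/eqP/val_inj.
Qed.

(* Slicing along the first coordinate, a slice [S_t] has at most [|T| - |S|]
   elements when that coordinate is shifted, so its own inequality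
   [|S_t|^(d-1) <= (|T_t| - |S_t|)^d] gives [|S_t|^d <= (|T| - |S|) (|T_t| - |S_t|)^d],
   and these add up by [sum_pow_le]. *)
Lemma isoperimetry (m : bitseq) (S T : seq (seq nat)) :
  uniq S -> uniq T -> S != [::] ->
  (forall z, z \in T -> size z = size m) ->
  {subset S <= T} ->
  (forall s i, s \in S -> nth false m i -> incr_nth s i \in T) ->
  (size S ^ (count id m).-1 <= (size T - size S) ^ count id m)%N.
Proof.
elim: m S T => [|b m IH] S T US UT S0 sT ST shT //.
have sS z : z \in S -> size z = (size m).+1 by move/ST/sT.
pose L := (\max_(z <- T) head 0%N z).+1.
have LT z : z \in T -> (head 0%N z < L)%N.
  by move=> zT; rewrite ltnS; apply: leq_bigmax_seq.
have LS z : z \in S -> (head 0%N z < L)%N by move/ST/LT.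
pose a t := size (slice t S); pose D t := (size (slice t T) - a t)%N.
have subt t : {subset slice t S <= slice t T}.
  by move=> s; rewrite (mem_slice _ _ sS) (mem_slice _ _ sT); apply: ST.
have leat t : (a t <= size (slice t T))%N.
  by apply: uniq_leq_size => //; exact: (uniq_slice _ sS US).
have ES : size S = (\sum_(t < L) a t)%N by apply: size_slices.
have ED : (size T - size S = \sum_(t < L) D t)%N.
  rewrite (size_slices LT) ES.
  apply/eqP; rewrite -(eqn_add2r (\sum_(t < L) a t)%N) subnK; last exact: leq_sum.
  by rewrite -big_split; apply/eqP/eq_bigr => t _; rewrite /= /D subnK.
have IHt t : (0 < a t)%N -> (a t ^ (count id m).-1 <= D t ^ count id m)%N.
  move=> at0; apply: IH => //.
  - exact: (uniq_slice _ sS US).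
  - exact: (uniq_slice _ sT UT).
  - by rewrite -size_eq0 -lt0n.
  - by move=> z; rewrite (mem_slice _ _ sT) => /sT [].
  move=> s i; rewrite (mem_slice _ _ sS) (mem_slice _ _ sT) => Hs mi.
  exact: (shT _ i.+1 Hs mi).
have aD M t : (0 < count id m)%N -> (a t <= M)%N ->
    (a t ^ count id m <= M * D t ^ count id m)%N.
  move=> d0 aM; case: (posnP (a t)) => [->|at0]; first by rewrite exp0n.
  by rewrite -[X in (a t ^ X)%N](prednK d0) expnS leq_mul // IHt.
have S0' : (0 < size S)%N by rewrite lt0n size_eq0.
(* An unshifted coordinate gives no bound on a slice beyond |S_t| <= |S|. The sum then yields |S|^d
   <= |S| (|T| - |S|)^d, and one factor |S| cancels. *)
case: b sT shT => sT shT /=; last first.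
  rewrite add0n ED; case: (posnP (count id m)) => [->//|d0].
  rewrite -(leq_pmul2l S0') -expnS prednK // {1}ES.
  apply: sum_pow_le => // t; apply: aD => //.
  by rewrite ES (bigD1 t) //= leq_addr.
have step t : (a t <= a t.+1 + D t.+1)%N.
  rewrite /D subnKC //; apply: uniq_leq_size; first exact: (uniq_slice _ sS US).
  by move=> s; rewrite (mem_slice _ _ sS) (mem_slice _ _ sT) => /(shT _ 0%N) /(_ isT).
have aL t : (L <= t)%N -> a t = 0%N.
  move=> Lt; apply/eqP; rewrite size_eq0; apply/eqP; case E: (slice t S) => [//|z l].
  have: z \in slice t S by rewrite E inE eqxx.
  by rewrite (mem_slice _ _ sS) => /LS /=; rewrite ltnNge Lt.
have DL t : (L <= t)%N -> D t = 0%N.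
  move=> Lt; rewrite /D; case E: (slice t T) => [//|z l].
  have: z \in slice t T by rewrite E inE eqxx.
  by rewrite (mem_slice _ _ sT) => /LT /=; rewrite ltnNge Lt.
(* Shifting the first coordinate embeds S_t in T_(t+1). Telescoping this until the slices are empty
   leaves only the excesses D_i with i > t, whose sum is at most |T| - |S|. *)
have aM t : (a t <= size T - size S)%N.
  case: (ltnP t L) => tL; last by rewrite aL.
  apply: (leq_trans (telescope_le t (L - t) step)).
  rewrite subnKC ?(ltnW tL) // aL // add0n ED -(big_mkord xpredT D).
  rewrite big_nat_recr //= DL // addn0 [leqRHS](@big_cat_nat _ _ _ t.+1) //=.
  exact: leq_addl.
(* If no other coordinate is shifted, the claim is |T| > |S|, and [aM] at a nonempty slice gives
   it. *)
rewrite add1n /= expnS; case: (posnP (count id m)) => [d0|d0].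
  rewrite d0 !expn0 muln1.
  have [s Ss] : exists s, s \in S by case: (S) S0 => // s l; exists s; rewrite inE eqxx.
  apply: leq_trans (aM (head 0%N s)); rewrite lt0n size_eq0.
  have := sS _ Ss; case: s Ss => //= h s Ss _.
  by apply/eqP => E; have := mem_slice h s sS; rewrite E Ss.
rewrite {1}ES {2}ED; apply: sum_pow_le => // t; exact: aD.
Qed.

(** * Differential operators and their symbols *)

Section DifferentialOperators.
Variables (k : fieldType) (B : comAlgType k).
Implicit Types (x y g : B) (d f : B -> B) (xs : seq B) (al : seq nat).

Definition ad x d : B -> B := (d \o mulop x) - (mulop x \o d).

Definition is_derivation d : Prop :=
  klinear d /\ forall a b : B, d (a * b) = d a * b + a * d b.

Lemma klinear0 d : klinear d -> d 0 = 0.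
Proof. by move=> dL; have := dL (-1) 0 0; rewrite scaler0 addr0 scaleN1r addNr. Qed.

Lemma klinearD d : klinear d -> {morph d : a b / a + b}.
Proof. by move=> dL a b; have := dL 1 a b; rewrite !scale1r. Qed.

Lemma klinearZ d : klinear d -> forall c a, d (c *: a) = c *: d a.
Proof. by move=> dL c a; have := dL c a 0; rewrite (klinear0 dL) !addr0. Qed.

Lemma klinearB d : klinear d -> {morph d : a b / a - b}.
Proof.
by move=> dL a b; rewrite -scaleN1r (klinearD dL) (klinearZ dL) scaleN1r.
Qed.

Lemma ad_lin x (c : k) d f : ad x (c *: d + f) = c *: ad x d + ad x f.
Proof.
apply/funext => y; rewrite /ad /mulop !fctE mulrDr scalerDr scalerN -scalerAr opprD.
by rewrite addrACA.
Qed.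

Lemma ad0 x : ad x 0 = 0.
Proof. by apply/funext => y; rewrite /ad /mulop !fctE mulr0 subr0. Qed.

Lemma adC x y d : ad x (ad y d) = ad y (ad x d).
Proof.
apply/funext => z; rewrite /ad /mulop !fctE (mulrCA y x z); ring.
Qed.

Lemma ad_mulop x y : ad x (mulop y) = 0.
Proof. by apply/funext => z; rewrite /ad /mulop !fctE mulrCA subrr. Qed.

Lemma ad_mulop_comp x y d : ad x (mulop y \o d) = mulop y \o ad x d.
Proof. by apply/funext => z; rewrite /ad /mulop !fctE mulrBr (mulrCA x y). Qed.

(** Leibniz rule for commutators; the coefficient [1] gives the right side the shape [c *: d + f]
    expected by the linearity lemmas. *)
Lemma ad_comp x f d : klinear f -> ad x (f \o d) = 1 *: (f \o ad x d) + (ad x f \o d).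
Proof.
move=> fL; apply/funext => z; rewrite scale1r /ad /mulop !fctE (klinearB fL).
ring.
Qed.

Lemma ad_derivation x f d : is_derivation f ->
  ad x (f \o d) = 1 *: (f \o ad x d) + (mulop (f x) \o d).
Proof.
move=> [fL fM]; rewrite ad_comp //; congr (_ + _); apply/funext => z.
by rewrite /ad /mulop !fctE fM addrK.
Qed.

Lemma klinear_lin (c : k) d f : klinear d -> klinear f -> klinear (c *: d + f).
Proof.
move=> dL fL a u v; rewrite !fctE dL fL !scalerDr !scalerA (mulrC c a).
by rewrite addrACA.
Qed.

Lemma klinear_mulop x : klinear (mulop x).
Proof. by move=> c u v; rewrite /mulop mulrDr scalerAr. Qed.

Lemma klinear_comp d f : klinear d -> klinear f -> klinear (d \o f).
Proof. by move=> dL fL c u v; rewrite /= fL dL. Qed.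

Lemma diffop_klinear m d : diffop m d -> klinear d.
Proof. by case: m => [[a ->]|m []] //; apply: klinear_mulop. Qed.

Lemma diffop0 m : diffop m (0 : B -> B).
Proof.
elim: m => [|m IH]; first by exists 0; apply/funext => z; rewrite /mulop mul0r.
split=> [c u v|a]; first by rewrite -[LHS]/(0 : B) -[RHS]/(c *: (0 : B) + 0) scaler0 addr0.
by rewrite -[_ - _]/(ad a 0) ad0.
Qed.

Lemma diffop_lin m (c : k) d f : diffop m d -> diffop m f -> diffop m (c *: d + f).
Proof.
elim: m d f => [|m IH] d f.
  move=> [a ->] [b ->]; exists (c *: a + b); apply/funext => z.
  by rewrite /mulop !fctE mulrDl scalerAl.
move=> [dL dA] [fL fA]; split; first exact: klinear_lin.
by move=> a; rewrite -[_ - _]/(ad a _) ad_lin; apply: IH; [apply: dA | apply: fA].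
Qed.

Lemma diffopS m d : diffop m d -> diffop m.+1 d.
Proof.
elim: m d => [|m IH] d; last by move=> [dL dA]; split=> // a; apply: IH; apply: dA.
move=> [a ->]; split; first exact: klinear_mulop.
by move=> b; rewrite -[_ - _]/(ad b _) ad_mulop; apply: (diffop0 0).
Qed.

Lemma diffop_le m m' d : (m <= m')%N -> diffop m d -> diffop m' d.
Proof.
move=> /subnK <-; elim: (m' - m)%N => // r IH Hd; rewrite addSn; exact/diffopS/IH.
Qed.

Lemma diffop_ad m x d : diffop m d -> diffop m.-1 (ad x d).
Proof.
case: m => [[a ->]|m [_ H]]; last exact: H.
by rewrite ad_mulop; apply: (diffop0 0).
Qed.

Lemma diffop_comp m m' d f : diffop m d -> diffop m' f -> diffop (m + m') (d \o f).
Proof.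
move: {2}(m + m')%N (erefl (m + m')%N) => N.
elim: N m m' d f => [|N IH] m m' d f EN Hd Hf.
  move: EN Hd Hf; case: m m' => [|//] [|//] _ [a ->] [b ->].
  by exists (a * b); apply/funext => z; rewrite /mulop /= mulrA.
have [dL fL] := (diffop_klinear Hd, diffop_klinear Hf).
rewrite EN; split; first exact: klinear_comp.
move=> a; rewrite -[_ - _]/(ad a _) ad_comp //.
apply: diffop_lin.
  case: m' Hf EN => [[b ->] _|m' Hf EN].
    rewrite ad_mulop (_ : d \o 0 = 0); first exact: diffop0.
    by apply/funext => z; rewrite /= (klinear0 dL).
  by move: EN; rewrite addnS => -[EN]; rewrite -EN; apply: IH => //; apply: (diffop_ad a Hf).
case: m Hd EN => [[b ->] _|m Hd EN].
  by rewrite ad_mulop; apply: diffop0.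
by move: EN; rewrite addSn => -[EN]; rewrite -EN; apply: IH => //; apply: (diffop_ad a Hd).
Qed.

Lemma diffop_derivation d : is_derivation d -> diffop 1 d.
Proof.
move=> [dL dM]; split=> // a; exists (d a); apply/funext => z.
by rewrite /mulop !fctE dM addrK.
Qed.

(** Missing exponents read as 0, so lists of any length are accepted. Evaluating at 1 loses nothing
    once all commutators with the x_i vanish, since the operator is then a multiplication
    ([diffop_commute]). *)
Fixpoint sym xs al d : B :=
  if xs is x :: xs' then sym xs' (behead al) (iter (head 0%N al) (ad x) d) else d 1.

Lemma iter_ad_lin a x (c : k) d f :
  iter a (ad x) (c *: d + f) = c *: iter a (ad x) d + iter a (ad x) f.
Proof. by elim: a => //= a ->; rewrite ad_lin. Qed.

Lemma sym_lin xs al (c : k) d f :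
  sym xs al (c *: d + f) = c *: sym xs al d + sym xs al f.
Proof. by elim: xs al d f => //= x xs IH al d f; rewrite iter_ad_lin IH. Qed.

Lemma sym0 xs al : sym xs al 0 = 0.
Proof. by have := sym_lin xs al (-1) 0 0; rewrite scaler0 addr0 scaleN1r addNr. Qed.

Lemma sym_mulop xs al x d : sym xs al (mulop x \o d) = x * sym xs al d.
Proof.
elim: xs al d => //= y xs IH al d; rewrite -IH; congr sym.
by elim: (head _ _) => //= a ->; rewrite ad_mulop_comp.
Qed.

Lemma diffop_iter_ad m a x d : diffop m d -> diffop (m - a) (iter a (ad x) d).
Proof.
by move=> Hd; elim: a => [|a IH]; rewrite ?subn0 //= subnS; apply: diffop_ad.
Qed.

Lemma iter_ad_eq0 m a x d : diffop m d -> (m < a)%N -> iter a (ad x) d = 0.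
Proof.
move=> Hd ma; rewrite -(subnK ma) iterD iterS.
have := diffop_iter_ad m x Hd; rewrite subnn => -[b ->]; rewrite ad_mulop.
by elim: (_ - _)%N => //= r ->; rewrite ad0.
Qed.

Lemma sym_neq0_le m xs al d i : diffop m d -> sym xs al d != 0 -> (i < size xs)%N ->
  (nth 0%N al i <= m)%N.
Proof.
elim: xs al d i => //= x xs IH al d i Hd H0 Hi.
rewrite leqNgt; apply/negP => lt.
case: i Hi lt => [|i] Hi lt.
  by move: H0; rewrite (iter_ad_eq0 x Hd) ?sym0 ?eqxx // -nth0.
have := IH (behead al) _ i (diffop_le (leq_subr _ _) (diffop_iter_ad _ x Hd)) H0 Hi.
by rewrite nth_behead leqNgt lt.
Qed.

(** The commutator of [f] with [x] is multiplication by [f x], which commutes with [x]; so at most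
    one of the [a] commutators can fall on [f]. For [a = 0] the truncated predecessor is harmless,
    its coefficient being 0. *)
Lemma iter_ad_derivation a x f d : is_derivation f ->
  iter a (ad x) (f \o d) =
  a%:R *: (mulop (f x) \o iter a.-1 (ad x) d) + (f \o iter a (ad x) d).
Proof.
move=> Hf; elim: a => [|a IH]; first by rewrite scale0r add0r.
rewrite [LHS]/= IH ad_lin ad_mulop_comp ad_derivation // addrA addrAC; congr (_ + _); last by rewrite scale1r.
case: a {IH} => [|a] /=; first by rewrite scale0r add0r scale1r.
by rewrite -{2}[mulop _ \o _]scale1r -scalerDl natr1.
Qed.

Lemma sym_derivation0 xs al f d i : is_derivation f ->
  (forall j, (j < size xs)%N -> j != i -> f xs`_j = 0) -> nth 0%N al i = 0%N ->
  sym xs al (f \o d) = f (sym xs al d).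
Proof.
move=> Hf; elim: xs al d i => //= x xs IH al d i fx ali.
rewrite iter_ad_derivation //.
have -> : (head 0%N al)%:R *: (mulop (f x) \o iter (head 0%N al).-1 (ad x) d) = 0.
  apply/funext => z; rewrite !fctE /mulop.
  case: i fx ali => [|i] fx ali; first by rewrite -nth0 ali scale0r.
  by rewrite (fx 0%N) // mul0r scaler0.
rewrite add0r; case: i fx ali => [|i] fx ali; last first.
  apply: (IH _ _ i); last by rewrite nth_behead.
  by move=> j lj ji; apply: (fx j.+1).
(* The variable with nonzero [f x] has been passed; [size al] is an index where the exponent is 0 by
   default, so that no exceptional variable remains. *)
apply: (IH _ _ (size al)); last by rewrite nth_default // size_behead leq_pred.
by move=> j lj _; apply: (fx j.+1).
Qed.

(** Only commutators with x_i can fall on [f]. This is the shift of an order index in the lower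
    bound: beyond the leading index the first summand vanishes, and the second is a nonzero multiple
    of the old symbol. *)
Lemma sym_derivationS xs al f d i : is_derivation f -> (i < size xs)%N ->
  (forall j, (j < size xs)%N -> j != i -> f xs`_j = 0) ->
  sym xs (incr_nth al i) (f \o d) =
  f (sym xs (incr_nth al i) d) + (nth 0%N al i).+1%:R *: (f xs`_i * sym xs al d).
Proof.
move=> Hf; elim: xs al d i => //= x xs IH al d i Hi fx.
rewrite iter_ad_derivation //; case: i Hi fx => [|i] Hi fx.
  rewrite sym_lin sym_mulop addrC; congr (_ + _); last by case: al.
  apply: (@sym_derivation0 _ _ _ _ (size (behead (incr_nth al 0)))) => //; last by rewrite nth_default.
  by move=> j lj _; apply: (fx j.+1).
have -> (c : k) h : c *: (mulop (f x) \o h) = 0.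
  by apply/funext => z; rewrite !fctE /mulop (fx 0%N) // mul0r scaler0.
rewrite add0r (_ : behead (incr_nth al i.+1) = incr_nth (behead al) i); last by case: al => //=; case: i {Hi fx}.
rewrite (_ : head 0%N (incr_nth al i.+1) = head 0%N al); last by case: al.
rewrite IH ?nth_behead // => j lj ji; exact: (fx j.+1).
Qed.

Section Injectivity.
Variable xs0 : seq B.
Hypothesis derivation_eq0 : forall d, is_derivation d ->
  (forall x, x \in xs0 -> d x = 0) -> forall b, d b = 0.

Lemma diffop_commute m d : diffop m d -> (forall x, x \in xs0 -> ad x d = 0) ->
  d = mulop (d 1).
Proof.
elim: m d => [|m IH] d Hd Hx.
  by case: Hd => a ->; apply/funext => z; rewrite /mulop mulr1.
have dL := diffop_klinear Hd.
(* By [adC] the commutator of [d] with [b] still commutes with the x_i and has lower order, so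
   induction makes it a multiplication. That is what makes b -> [d,b](1) a derivation. *)
have adE b : ad b d = mulop (ad b d 1).
  by apply: IH => [|x /Hx dx]; [apply: (diffop_ad b Hd) | rewrite adC dx ad0].
have ad1 b : ad b d 1 = d b - b * d 1 by rewrite /ad /mulop !fctE mulr1.
have der : is_derivation (fun b => ad b d 1).
  split=> [c u v|a b]; first by rewrite !ad1 dL mulrDl -scalerAl scalerBr opprD addrACA.
  have := congr1 (fun h => h b) (adE a); rewrite {1}/ad /mulop !fctE => E.
  rewrite -E !ad1 mulrBr; rewrite addrA addrNK mulrA //.
apply/funext => z; apply/eqP; rewrite /mulop mulrC -subr_eq0 -ad1; apply/eqP.
by apply: (derivation_eq0 der) => x /Hx ->.
Qed.

(** Variables move from [xs] to [ys], the list of those already known to commute with the operator.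
    For the head x the power of [ad x] is lowered step by step: if (ad x)^(a+1) d = 0, then (ad x)^a
    d commutes with x, and the induction over [xs] makes it vanish. *)
Lemma sym_inj_aux (ys : seq B) xs m d : diffop m d ->
  (forall x, x \in xs0 -> x \in ys \/ x \in xs) ->
  (forall y, y \in ys -> ad y d = 0) ->
  (forall al, size al = size xs -> sym xs al d = 0) -> d = 0.
Proof.
elim: xs ys m d => [|x xs IH] ys m d Hd Hxs Hys H.
  rewrite (diffop_commute Hd) => [|x /Hxs[/Hys|]//].
  by have /= -> := H [::] erefl; apply/funext => z; rewrite /mulop mul0r.
suff E j : iter (m.+1 - j) (ad x) d = 0 by have := E m.+1; rewrite subnn.
elim: j => [|j IHj]; first by rewrite subn0 (iter_ad_eq0 x Hd).
case: (ltnP j m.+1) => jm; last by move: IHj; rewrite subnS (eqP jm).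
apply: (IH (x :: ys) _ _ (diffop_iter_ad _ x Hd)).
- by move=> y /Hxs; rewrite !inE => -[->|/orP[->|->]]; rewrite ?orbT; auto.
- move=> y; rewrite inE => /orP[/eqP ->|yys].
    by rewrite -iterS -subSn // subSS IHj.
  have -> a : ad y (iter a (ad x) d) = iter a (ad x) (ad y d).
    by elim: a => //= a <-; rewrite adC.
  by rewrite Hys //; elim: (_ - _)%N => //= a ->; rewrite ad0.
by move=> al sal; apply: (H (_ :: al)); rewrite /= sal.
Qed.

Lemma sym_inj m d : diffop m d ->
  (forall al, size al = size xs0 -> sym xs0 al d = 0) -> d = 0.
Proof. by move=> Hd; apply: (@sym_inj_aux [::] xs0 m) => //; right. Qed.

End Injectivity.
End DifferentialOperators.

(** * Monomials, algebraic elements and extension of derivations *)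

Section Monomials.
Variables (k : fieldType) (B : comAlgType k).
Implicit Types (x y : B) (xs : seq B) (al be : seq nat) (A : set B).

Fixpoint mon xs be : B :=
  if xs is x :: xs' then x ^+ head 0%N be * mon xs' (behead be) else 1.

Lemma mon_incr xs be i : (i < size xs)%N -> mon xs (incr_nth be i) = xs`_i * mon xs be.
Proof.
elim: xs be i => //= x xs IH [|b be] [|i] Hi //=.
- by rewrite expr0 mul1r expr1.
- rewrite (_ : ncons i 0%N [:: 1%N] = incr_nth [::] i); last by case: (i).
  by rewrite IH // !expr0 !mul1r.
- by rewrite exprS mulrA.
- by rewrite IH // mulrCA.
Qed.

Lemma mon_nseq0 xs m : mon xs (nseq m 0%N) = 1.
Proof. by elim: xs m => //= x xs IH [|m] /=; rewrite expr0 mul1r // (IH 0%N). Qed.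

Lemma monE xs be : mon xs be = \prod_(i < size xs) xs`_i ^+ nth 0%N be i.
Proof.
elim: xs be => [|x xs IH] be /=; first by rewrite big_ord0.
by rewrite big_ord_recl /= nth0 IH; congr (_ * _); apply: eq_bigr => i _; rewrite nth_behead.
Qed.

Definition addseq n al be := mkseq (fun i => nth 0 al i + nth 0 be i)%N n.

Lemma monM xs al be : mon xs al * mon xs be = mon xs (addseq (size xs) al be).
Proof.
rewrite !monE -big_split /=; apply: eq_bigr => i _.
by rewrite nth_mkseq // exprD.
Qed.

Lemma lspanM (P Q S : set B) a b :
  (forall p q, P p -> Q q -> lspan S (p * q)) -> lspan P a -> lspan Q b -> lspan S (a * b).
Proof.
move=> H Ha Hb; move: a Ha; apply: (lspan_bind (f := fun a => a * b)) => [c u v|p Pp].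
  by rewrite mulrDl scalerAl.
move: b Hb; apply: (lspan_bind (f := fun b => p * b)) => [c u v|q Qq]; last exact: H.
by rewrite mulrDr scalerAr.
Qed.

Record is_subalg A : Prop := IsSubalg {
  subalg1 : A 1;
  subalgD : forall a b, A a -> A b -> A (a + b);
  subalgM : forall a b, A a -> A b -> A (a * b);
  subalgZ : forall (c : k) a, A a -> A (c *: a) }.

Lemma subalg0 A : is_subalg A -> A 0.
Proof. by move=> HA; rewrite -(scale0r (1 : B)); apply: subalgZ => //; apply: subalg1. Qed.

Lemma subalg_sum A (I : Type) (r : seq I) (P : pred I) (F : I -> B) :
  is_subalg A -> (forall i, P i -> A (F i)) -> A (\sum_(i <- r | P i) F i).
Proof. by move=> HA H; apply: big_ind => //; [exact: subalg0 | exact: subalgD]. Qed.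

Lemma subalgX A a n : is_subalg A -> A a -> A (a ^+ n).
Proof.
by move=> HA Aa; elim: n => [|n IH]; rewrite ?exprS; [apply: subalg1 | apply: subalgM].
Qed.

Lemma subalg_gen A (s : seq B) : is_subalg A -> (forall x, x \in s -> A x) ->
  forall b, gen_by s b -> A b.
Proof.
move=> HA H b; elim=> *; [exact: H|exact: subalg1|exact: subalgD|exact: subalgM|exact: subalgZ].
Qed.

Lemma gen_subalg (s : seq B) : is_subalg (gen_by s).
Proof.
split; [exact: gen_one | by move=> *; apply: gen_add | by move=> *; apply: gen_mul |].
by move=> *; apply: gen_scale.
Qed.

Lemma lspan_subalg (P : set B) : P 1 -> (forall p q, P p -> P q -> P (p * q)) ->
  is_subalg (lspan P).
Proof.
move=> P1 PM; split; [exact: lspan_in | exact: lspanD | | exact: lspanZ].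
by move=> a b; apply: lspanM => p q Pp Pq; apply: lspan_in; apply: PM.
Qed.

(** Bounding each exponent instead of the total degree gives a box of (C+1)^n exponent lists, which
    [power_box] can enumerate. *)
Definition monomials xs (C : nat) : set B :=
  [set m | exists2 be, size be = size xs /\ all (fun b => b <= C)%N be & m = mon xs be].

Lemma monomialsM xs C D p q :
  monomials xs C p -> monomials xs D q -> monomials xs (C + D) (p * q).
Proof.
move=> [al [sa aC] ->] [be [sb bD] ->]; exists (addseq (size xs) al be); last exact: monM.
split; first by rewrite size_mkseq.
apply/allP => b /mapP[i]; rewrite mem_iota add0n => /andP[_ ix] ->.
by apply: leq_add; [apply: (allP aC) | apply: (allP bD)]; rewrite mem_nth ?sa ?sb.
Qed.

Lemma monomials_le xs C D p : (C <= D)%N -> monomials xs C p -> monomials xs D p.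
Proof.
move=> CD [be [sb bC] ->]; exists be => //; split=> //.
by apply: sub_all bC => b bC; apply: leq_trans CD.
Qed.

Lemma monomials1 xs C : monomials xs C 1.
Proof.
exists (nseq (size xs) 0%N); last by rewrite mon_nseq0.
by rewrite size_nseq; split=> //; apply/allP => b; rewrite mem_nseq => /andP[_ /eqP ->].
Qed.

Lemma gen_monomials xs a : gen_by xs a -> exists C, lspan (monomials xs C) a.
Proof.
have le C D : (C <= D)%N -> forall b, lspan (monomials xs C) b -> lspan (monomials xs D) b.
  by move=> CD; apply: lspan_sub => p Hp; apply: lspan_in; apply: monomials_le Hp.
elim=> [x xxs||x y _ [C HC] _ [D HD]|x y _ [C HC] _ [D HD]|c x _ [C HC]].
- exists 1%N; apply: lspan_in; exists (incr_nth (nseq (size xs) 0%N) (index x xs)); last first.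
    by rewrite mon_incr ?index_mem // nth_index // mon_nseq0 mulr1.
  rewrite size_incr_nth size_nseq index_mem xxs; split=> //.
  apply/(all_nthP 0%N) => i _; rewrite nth_incr_nth nth_nseq if_same addn0.
  by case: eqP.
- by exists 0%N; apply: lspan_in; apply: monomials1.
- by exists (maxn C D); apply: lspanD; [apply: le HC | apply: le HD]; rewrite ?leq_maxl ?leq_maxr.
- exists (C + D)%N; move: HC HD; apply: lspanM => p q Pp Pq.
  by apply: lspan_in; apply: monomialsM.
by exists C; apply: lspanZ.
Qed.

Lemma alg_indep_mon n (x : 'I_n -> B) : alg_indep x ->
  indep_on (mon [seq x i | i <- enum 'I_n]) (fun be => size be = n).
Proof.
move=> xI J c UJ JP H be beJ.
have sn : size [seq x i | i <- enum 'I_n] = n by rewrite size_map size_enum_ord.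
pose f be : {ffun 'I_n -> nat} := [ffun i : 'I_n => nth 0%N be i].
pose g (m : {ffun 'I_n -> nat}) := [seq m i | i <- enum 'I_n].
have fK : {in J, cancel f g}.
  move=> al /JP sal; rewrite /g /f; under eq_map => i do rewrite ffunE.
  by rewrite (map_comp (nth 0%N al) val) val_enum_ord -[X in iota _ X]sal -/(mkseq _ _) mkseq_nth.
have := xI (map f J) (c \o g) _ _ (f be) (map_f f beJ); rewrite /= fK //; apply.
  by rewrite map_inj_in_uniq //; apply: can_in_inj fK.
rewrite big_map -[RHS]H; apply: eq_big_seq => al aJ; rewrite /= fK //; congr (_ *: _).
rewrite monE sn; apply: eq_bigr => i _; rewrite ffunE.
by rewrite (nth_map i) ?size_enum_ord // nth_ord_enum.
Qed.

End Monomials.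

(** * Algebraic elements over a subalgebra *)

Section Domain.
Variables (k : fieldType) (B : comAlgType k).
Hypothesis Bdom : is_domain B.
Hypothesis char0 : [pchar k] =i pred0.
Implicit Types (x y b : B) (xs : seq B) (A : set B) (P Q : {poly B}).

Lemma dom_mul_neq0 x y : x != 0 -> y != 0 -> x * y != 0.
Proof. by move=> x0 y0; apply/eqP => /Bdom[] /eqP; apply/negP. Qed.

Lemma dom_exp_neq0 x n : x != 0 -> x ^+ n != 0.
Proof.
by move=> x0; elim: n => [|n IH]; rewrite ?expr0 ?oner_neq0 // exprS dom_mul_neq0.
Qed.

Lemma dom_prod_neq0 (I : Type) (r : seq I) (p : pred I) (F : I -> B) :
  (forall i, p i -> F i != 0) -> \prod_(i <- r | p i) F i != 0.
Proof. by move=> H; apply: (big_ind (fun x => x != 0)) => //; [exact: oner_neq0 | exact: dom_mul_neq0]. Qed.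

Lemma dom_mulI x y : x != 0 -> x * y = 0 -> y = 0.
Proof. by move=> x0 /Bdom[] // E; rewrite E eqxx in x0. Qed.

Lemma natr_neq0 n : (n.+1%:R : k) != 0.
Proof. by rewrite (pcharf0P _).1. Qed.

Definition coefs_in A P := forall i, A P`_i.

Definition alg_over A b := exists P, [/\ P != 0, coefs_in A P & P.[b] = 0].

(** Otherwise [b] and the x_i would be n+1 independent elements: a relation between them, grouped by
    powers of [b], is a polynomial in [b] over k[x] that must be zero, and each of its coefficients
    is a relation between the x_i. *)
Lemma trdeg_alg n (x : 'I_n -> B) b : trdeg_eq B n -> alg_indep x ->
  alg_over (gen_by [seq x i | i <- enum 'I_n]) b.
Proof.
move=> [_ trB] xI; set A := gen_by _.
have HA : is_subalg A by apply: gen_subalg.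
apply: contrapT => nalg.
have tr P : coefs_in A P -> P.[b] = 0 -> P = 0.
  by move=> AP Pb; apply: contrapT => /eqP P0; apply: nalg; exists P.
pose x' (i : 'I_n.+1) := if unlift ord0 i is Some j then x j else b.
suff /trB : alg_indep x' by rewrite ltnn.
move=> S c US HS m0 m0S.
pose mm (m : {ffun 'I_n.+1 -> nat}) : {ffun 'I_n -> nat} := [ffun i => m (lift ord0 i)].
pose M (m : {ffun 'I_n -> nat}) := \prod_(i < n) x i ^+ m i.
have E (m : {ffun 'I_n.+1 -> nat}) :
    \prod_(i < n.+1) x' i ^+ m i = b ^+ m ord0 * M (mm m).
  rewrite big_ord_recl {1}/x' unlift_none; congr (_ * _); apply: eq_bigr => i _.
  by rewrite /x' liftK ffunE.
have AM m : A (M m).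
  apply: (big_ind A) => [||i _]; [exact: subalg1 | exact: (subalgM HA) |].
  apply: subalgX => //; apply: gen_in; apply: map_f; exact: mem_enum.
pose P := \sum_(m <- S) (c m *: M (mm m))%:P * 'X^(m ord0).
have P0 : P = 0.
  apply: tr => [i|].
    rewrite coef_sum; apply: subalg_sum => // m _; rewrite coefCM coefXn.
    case: (_ == _); rewrite ?mulr1 ?mulr0; [|exact: subalg0].
    by apply: subalgZ.
  rewrite horner_sum -[RHS]HS; apply: eq_bigr => m _.
  by rewrite hornerM hornerC hornerXn E -scalerAl mulrC.
have := congr1 (fun Q : {poly B} => Q`_(m0 ord0)) P0; rewrite coef0 coef_sum.
under eq_bigr => m _ do rewrite coefCM coefXn mulr_natr mulrb.
rewrite -big_mkcond /= -big_filter => Hc.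
(* Inverse of [mm] on the multi-indices with the same exponent of [b] as [m0]. *)
pose ext (m : {ffun 'I_n -> nat}) : {ffun 'I_n.+1 -> nat} :=
  [ffun i => if unlift ord0 i is Some j then m j else m0 ord0].
have extK (m : {ffun 'I_n.+1 -> nat}) : m0 ord0 == m ord0 -> ext (mm m) = m.
  move=> /eqP mm0; apply/ffunP => i; rewrite ffunE.
  by case: unliftP => [j ->|->]; rewrite ?ffunE.
have := xI [seq mm m | m <- [seq m : {ffun 'I_n.+1 -> nat} <- S | m0 ord0 == m ord0]] (c \o ext) _ _ (mm m0) _.
rewrite /= extK //; apply.
- rewrite map_inj_in_uniq ?filter_uniq // => m m'; rewrite !mem_filter.
  by move=> /andP[e _] /andP[e' _] Emm; rewrite -(extK m e) -(extK m' e') Emm.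
- rewrite big_map -[RHS]Hc; apply: eq_big_seq => m; rewrite mem_filter => /andP[e _].
  by rewrite /= extK.
by apply: map_f; rewrite mem_filter eqxx.
Qed.

Lemma alg_over_sub A A' b : (forall a, A a -> A' a) -> alg_over A b -> alg_over A' b.
Proof. by move=> AA [P [P0 AP Pb]]; exists P; split=> // i; apply: AA. Qed.

(** There is no division in [A], so a polynomial of least degree replaces the minimal polynomial. If
    P'(b) were 0, then P' = 0 by minimality, P would be constant in characteristic zero, and its
    value at [b] would be nonzero. *)
Lemma min_poly A b : is_subalg A -> alg_over A b ->
  exists P, [/\ P != 0, coefs_in A P, P.[b] = 0, P^`().[b] != 0 &
    forall Q, coefs_in A Q -> Q.[b] = 0 -> (size Q < size P)%N -> Q = 0].
Proof.
move=> HA [P0 HP0].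
pose good m := `[< exists P, [/\ P != 0, coefs_in A P & P.[b] = 0] /\ size P = m >].
have ex : exists m, good m by exists (size P0); apply/asboolP; exists P0.
case: (ex_minnP ex) => m /asboolP[P [[Pn0 AP Pb] sP]] mmin.
have min Q : coefs_in A Q -> Q.[b] = 0 -> (size Q < size P)%N -> Q = 0.
  move=> AQ Qb; rewrite sP => lt; apply/eqP; apply: contraTT lt => Q0.
  by rewrite -leqNgt; apply: mmin; apply/asboolP; exists Q.
exists P; split=> //; apply/eqP => Pb'.
have D0 : P^`() = 0.
  apply: min => //; last exact: lt_size_deriv.
  by move=> i; rewrite coef_deriv -scaler_nat; apply: subalgZ.
have Pc : P = (P`_0)%:P.
  apply/polyP => -[|i]; rewrite coefC //=.
  have := congr1 (fun Q : {poly B} => Q`_i) D0; rewrite coef_deriv coef0 -scaler_nat.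
  by move/eqP; rewrite scaler_eq0 (negbTE (natr_neq0 i)) => /eqP.
by move: Pn0; rewrite Pc -(hornerC P`_0 b) -Pc Pb eqxx.
Qed.

Definition der_on A (d : B -> B) : Prop :=
  (forall c a b, A a -> A b -> d (c *: a + b) = c *: d a + d b) /\
  (forall a b, A a -> A b -> d (a * b) = d a * b + a * d b).

Section PolyDerivation.
Variables (A : set B) (d : B -> B) (b u v : B).
Hypotheses (HA : is_subalg A) (Hd : der_on A d).

Let d0 : d 0 = 0.
Proof.
have := Hd.1 (-1) 0 0 (subalg0 HA) (subalg0 HA).
by rewrite scaler0 addr0 scaleN1r addNr.
Qed.

Let dD a a' : A a -> A a' -> d (a + a') = d a + d a'.
Proof. by move=> Aa Aa'; have := Hd.1 1 _ _ Aa Aa'; rewrite !scale1r. Qed.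

Let d1 : d 1 = 0.
Proof.
have A1 := subalg1 HA; have := Hd.2 _ _ A1 A1; rewrite !mulr1 mul1r => /eqP.
by rewrite -subr_eq0 opprD addrA subrr sub0r oppr_eq0 => /eqP.
Qed.

Let d_sum n (F : 'I_n -> B) : (forall i, A (F i)) -> d (\sum_i F i) = \sum_i d (F i).
Proof.
elim: n F => [|n IH] F AF; first by rewrite !big_ord0.
rewrite !big_ord_recl dD ?IH //; exact: subalg_sum.
Qed.

(** The value at Q(b) of the extension of u d that sends b to v. Extending u d instead of d lets v
    be taken in [B], where division by u may be impossible. *)
Definition theta Q := u * (map_poly d Q).[b] + v * Q^`().[b].

Lemma coefs_inM P Q : coefs_in A P -> coefs_in A Q -> coefs_in A (P * Q).
Proof. by move=> AP AQ i; rewrite coefM; apply: subalg_sum => // j _; apply: subalgM. Qed.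

Lemma coefs_inC a : A a -> coefs_in A a%:P.
Proof. by move=> Aa i; rewrite coefC; case: eqP => // _; apply: subalg0. Qed.

Lemma coefs_inD P Q : coefs_in A P -> coefs_in A Q -> coefs_in A (P + Q).
Proof. by move=> AP AQ i; rewrite coefD; apply: subalgD. Qed.

Lemma coefs_inX : coefs_in A 'X.
Proof. by move=> i; rewrite coefX; case: eqP => _; [apply: subalg1 | apply: subalg0]. Qed.

Lemma thetaD P Q : coefs_in A P -> coefs_in A Q -> theta (P + Q) = theta P + theta Q.
Proof.
move=> AP AQ; rewrite /theta derivD.
have -> : map_poly d (P + Q) = map_poly d P + map_poly d Q.
  by apply/polyP => i; rewrite coefD !coef_map_id0 // coefD dD.
by rewrite !hornerD; ring.
Qed.

Lemma thetaM P Q : coefs_in A P -> coefs_in A Q ->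
  theta (P * Q) = theta P * Q.[b] + P.[b] * theta Q.
Proof.
move=> AP AQ; rewrite /theta derivM.
have -> : map_poly d (P * Q) = map_poly d P * Q + P * map_poly d Q.
  apply/polyP => i; rewrite coefD !coefM coef_map_id0 // coefM d_sum; last first.
    by move=> j; apply: subalgM.
  rewrite -big_split /=; apply: eq_bigr => j _.
  by rewrite !coef_map_id0 // Hd.2.
by rewrite !hornerD !hornerM; ring.
Qed.

Lemma thetaC a : A a -> theta a%:P = u * d a.
Proof.
move=> Aa; rewrite /theta derivC horner0 mulr0 addr0.
have -> : map_poly d a%:P = (d a)%:P.
  by apply/polyP => i; rewrite coef_map_id0 // !coefC; case: eqP.
by rewrite hornerC.
Qed.

Lemma thetaX : theta 'X = v.
Proof.
rewrite /theta derivX hornerC mulr1.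
have -> : map_poly d 'X = 0.
  by apply/polyP => i; rewrite coef_map_id0 // coefX coef0; case: eqP.
by rewrite horner0 mulr0 add0r.
Qed.

Definition adjoin : set B := [set y | exists2 Q, coefs_in A Q & y = Q.[b]].

Lemma adjoin_sub a : A a -> adjoin a.
Proof. by move=> Aa; exists a%:P; [apply: coefs_inC | rewrite hornerC]. Qed.

Lemma adjoin_gen : adjoin b.
Proof. by exists 'X; [apply: coefs_inX | rewrite hornerX]. Qed.

Lemma adjoin_subalg : is_subalg adjoin.
Proof.
split.
- by apply: adjoin_sub; apply: subalg1.
- by move=> _ _ [P AP ->] [Q AQ ->]; exists (P + Q); [apply: coefs_inD | rewrite hornerD].
- by move=> _ _ [P AP ->] [Q AQ ->]; exists (P * Q); [apply: coefs_inM | rewrite hornerM].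
move=> c _ [P AP ->]; exists ((c *: 1)%:P * P).
  by apply: coefs_inM => //; apply: coefs_inC; apply: subalgZ => //; apply: subalg1.
by rewrite hornerM hornerC -scalerAl mul1r.
Qed.

Lemma extend_derivation :
  (forall Q, coefs_in A Q -> Q.[b] = 0 -> theta Q = 0) ->
  exists d', [/\ der_on adjoin d', forall a, A a -> d' a = u * d a & d' b = v].
Proof.
move=> WD.
have AZ c P : coefs_in A P -> coefs_in A ((c *: 1)%:P * P).
  by move=> AP; apply: coefs_inM => //; apply: coefs_inC; apply: subalgZ => //; apply: subalg1.
have tZ c P : coefs_in A P -> theta ((c *: 1)%:P * P) = c *: theta P.
  move=> AP; have Ac : A (c *: 1) by apply: subalgZ => //; apply: subalg1.
  rewrite thetaM ?thetaC //; last exact: coefs_inC.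
  have -> : d (c *: 1) = 0.
    by have := Hd.1 c 1 0 (subalg1 HA) (subalg0 HA); rewrite !addr0 d1 d0 scaler0 addr0.
  by rewrite mulr0 mul0r add0r hornerC -scalerAl mul1r.
(* [q] picks a polynomial representing each element of A[b]; by [WD] the value of [theta] does not
   depend on the pick. *)
have /choice[q Hq] : forall y, exists Q, adjoin y -> coefs_in A Q /\ y = Q.[b].
  by move=> y; have [[Q AQ E]|H] := pselect (adjoin y); [exists Q | exists 0].
have dE P : coefs_in A P -> theta (q P.[b]) = theta P.
  move=> AP; have [|Aq Eq] := Hq P.[b]; first by exists P.
  pose m1 : k := -1.
  have E0 : ((m1 *: 1)%:P * P + q P.[b]).[b] = 0.
    by rewrite hornerD hornerM hornerC -Eq -scalerAl mul1r scaleN1r addNr.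
  have := WD _ (coefs_inD (AZ _ _ AP) Aq) E0.
  rewrite thetaD ?tZ //; last exact: AZ.
  by move=> /eqP; rewrite scaleN1r addrC subr_eq0 => /eqP.
exists (fun y => theta (q y)); split.
- split=> [c _ _ [P AP ->] [Q AQ ->]|_ _ [P AP ->] [Q AQ ->]].
    rewrite (_ : _ + _ = ((c *: 1)%:P * P + Q).[b]); last first.
      by rewrite hornerD hornerM hornerC -scalerAl mul1r.
    by rewrite !dE ?thetaD ?tZ //; [apply: AZ | apply: coefs_inD => //; apply: AZ].
  by rewrite -hornerM !dE ?thetaM //; apply: coefs_inM.
- by move=> a Aa; rewrite -[a in LHS](hornerC a b) dE ?thetaC //; apply: coefs_inC.
by rewrite -[b in LHS](hornerX b) dE ?thetaX //; apply: coefs_inX.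
Qed.

End PolyDerivation.

End Domain.

(** * Derivations dual to a transcendence basis *)

Section Derivations.
Variables (k : fieldType) (B : comAlgType k).
Hypothesis Bdom : is_domain B.
Hypothesis char0 : [pchar k] =i pred0.
Implicit Types (x y b : B) (xs : seq B) (A : set B) (P Q : {poly B}).

(** Applying [d] to P(b) = 0 gives P'(b) d(b) = 0, and P'(b) is nonzero. *)
Lemma derivation_alg_eq0 A d b : is_subalg A -> is_derivation d ->
  (forall a, A a -> d a = 0) -> alg_over A b -> d b = 0.
Proof.
move=> HA [dL dM] dA /(min_poly char0 HA)[P [_ AP Pb P'b _]].
have E Q : coefs_in A Q -> d Q.[b] = Q^`().[b] * d b.
  elim/poly_ind: Q => [|Q c IH] AQ; first by rewrite deriv0 !horner0 (klinear0 dL) mul0r.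
  have AQ' : coefs_in A Q by move=> i; have := AQ i.+1; rewrite coefD coefMX coefC addr0.
  have Ac : A c by have := AQ 0%N; rewrite coefD coefMX coefC add0r.
  rewrite derivMXaddC !hornerE (klinearD dL) dM IH // (dA _ Ac); ring.
by apply: (dom_mulI Bdom P'b); rewrite -E // Pb (klinear0 dL).
Qed.

Lemma alg_extend_derivation A d b : is_subalg A -> der_on A d -> alg_over A b ->
  exists d' h, [/\ h != 0, der_on (adjoin A b) d' & forall a, A a -> d' a = h * d a].
Proof.
move=> HA Hd /(min_poly char0 HA)[P [P0 AP Pb P'b Pmin]].
(* Differentiating P(b) = 0 forces the value at b to be v / P'(b); scaling the derivation by P'(b)
   removes the denominator. *)
pose v := - (map_poly d P).[b].
have d0 : d 0 = 0.
  have := Hd.1 (-1) 0 0 (subalg0 HA) (subalg0 HA).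
  by rewrite scaler0 addr0 scaleN1r addNr.
have tP : theta d b P^`().[b] v P = 0 by rewrite /theta /v; ring.
suff WD Q : coefs_in A Q -> Q.[b] = 0 -> theta d b P^`().[b] v Q = 0.
  have [d' [Hd' d'A _]] := extend_derivation HA Hd WD.
  by exists d', P^`().[b].
have [s] := ubnP (size Q); elim: s Q => // s IH Q; rewrite ltnS => sQ AQ Qb.
case: (ltnP (size Q) (size P)) => [/(Pmin _ AQ Qb) ->|PQ].
  by rewrite -[0]/(0%:P) (thetaC _ _ _ HA Hd) ?d0 ?mulr0 //; apply: subalg0.
pose m := (size Q - size P)%N.
(* One step of pseudo-division: Q is multiplied by the leading coefficient of P so that subtracting
   a multiple of P lowers the degree. As P and Q vanish at b and [theta] kills P, the Leibniz rule
   gives lead_coef P times [theta] of Q for the combination. *)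
pose T := (- lead_coef Q)%:P * 'X^m.
have AXn j : coefs_in A 'X^j.
  by move=> i; rewrite coefXn; case: eqP => _; [apply: subalg1 | apply: subalg0].
have AlP : A (lead_coef P) by apply: AP.
have AlQ : A (- lead_coef Q).
  by rewrite -scaleN1r; apply: subalgZ => //; apply: AQ.
have AT : coefs_in A T by apply: (coefs_inM HA) => //; apply: (coefs_inC HA).
have ACQ : coefs_in A ((lead_coef P)%:P * Q).
  by apply: (coefs_inM HA) => //; apply: (coefs_inC HA).
have ATP : coefs_in A (T * P) by apply: (coefs_inM HA).
have sP : (0 < size P)%N by rewrite lt0n size_poly_eq0.
have : theta d b P^`().[b] v ((lead_coef P)%:P * Q + T * P) = 0.
  apply: IH; last first.
  - by rewrite hornerD !hornerM Qb Pb !mulr0 addr0.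
  - by apply: coefs_inD.
  apply: leq_ltn_trans (_ : (size Q).-1 < s)%N; last first.
    by rewrite prednK // (leq_trans sP PQ).
  apply/leq_sizeP => j Hj; rewrite coefD /T -mulrA !coefCM coefXnM.
  have jm : (m <= j)%N by apply: leq_trans Hj; rewrite /m -subn1 leq_sub2l.
  rewrite ltnNge jm /=.
  case: (ltngtP j (size Q).-1) => [|Hj'|->]; first by rewrite ltnNge Hj.
    have Hj2 : (size Q <= j)%N by rewrite -(prednK (leq_trans sP PQ)).
    rewrite (nth_default _ Hj2) nth_default ?mulr0 ?addr0 //.
    by rewrite /m leq_subRL // subnK.
  have -> : ((size Q).-1 - m = (size P).-1)%N.
    by rewrite /m -!subn1 subnAC subKn.
  by rewrite -!/(lead_coef _) mulNr mulrC subrr.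
rewrite (thetaD _ _ _ HA Hd ACQ ATP) !(thetaM _ _ _ HA Hd) //; try exact: (coefs_inC HA).
rewrite Qb Pb tP !mulr0 addr0 add0r addr0 hornerC.
by apply: dom_mulI; rewrite // lead_coef_eq0.
Qed.

Lemma alg_extend_derivation_seq (s : seq B) A d : is_subalg A -> der_on A d ->
  (forall b, b \in s -> alg_over A b) ->
  exists A' d' h, [/\ is_subalg A', der_on A' d', h != 0,
    forall b, b \in s -> A' b & forall a, A a -> A' a /\ d' a = h * d a].
Proof.
move=> HA Hd; elim: s => [|b s IH] Hs.
  exists A, d, 1; split=> //; first exact: oner_neq0.
  by move=> a Aa; rewrite mul1r.
have [|A1 [d1 [h1 [HA1 Hd1 h10 sA1 AA1]]]] := IH; first by move=> c cs; apply: Hs; rewrite inE cs orbT.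
have [|d2 [h2 [h20 Hd2 d21]]] := @alg_extend_derivation A1 d1 b HA1 Hd1.
  by apply: (@alg_over_sub _ _ A) => [a /AA1[]//|]; apply: Hs; rewrite inE eqxx.
exists (adjoin A1 b), d2, (h2 * h1); split=> //.
- exact: adjoin_subalg.
- exact: dom_mul_neq0.
- move=> c; rewrite inE => /orP[/eqP ->|/sA1 A1c]; first exact: adjoin_gen.
  exact: adjoin_sub.
by move=> a /AA1[A1a Ea]; split; [apply: adjoin_sub | rewrite d21 // Ea mulrA].
Qed.

Section Dual.
Variable xs : seq B.
Hypothesis xsI : indep_on (mon xs) (fun be => size be = size xs).
Hypothesis xs_alg : forall b, alg_over (gen_by xs) b.
Hypothesis Bfg : finitely_generated B.

Lemma mon_gen j : (j < size xs)%N -> xs`_j = mon xs (incr_nth (nseq (size xs) 0%N) j).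
Proof. by move=> jx; rewrite mon_incr // mon_nseq0 mulr1. Qed.

Lemma dual_derivation i : (i < size xs)%N -> exists f g,
  [/\ is_derivation f, g != 0, f xs`_i = g &
      forall j, (j < size xs)%N -> j != i -> f xs`_j = 0].
Proof.
move=> ix; pose n := size xs.
pose e (Q : set (seq nat)) : set B := fun z => exists2 be, Q be & z = mon xs be.
pose deg l : set (seq nat) := fun be => size be = n /\ nth 0%N be i = l.
pose A := lspan (e (deg 0%N)).
have HA : is_subalg A.
  apply: lspan_subalg.
    by exists (nseq n 0%N); rewrite ?mon_nseq0 // /deg size_nseq nth_nseq if_same.
  move=> _ _ [al [sa a0] ->] [be [sb b0] ->]; exists (addseq n al be); last exact: monM.
  by rewrite /deg size_mkseq nth_mkseq // a0 b0.
have Ax j : (j < n)%N -> j != i -> A xs`_j.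
  move=> jx ji; apply: lspan_in; exists (incr_nth (nseq n 0%N) j); last exact: mon_gen.
  rewrite /deg size_incr_nth size_nseq jx nth_incr_nth nth_nseq if_same addn0.
  by rewrite (negbTE ji).
have Hd : der_on A (fun _ => 0).
  by split=> *; rewrite ?scaler0 ?mul0r ?mulr0 addr0.
(* x_i is transcendental over [A]: the l-th term of Q(x_i) involves only monomials with i-th
   exponent l and the other terms involve none of these, so each term vanishes. *)
have tr Q : coefs_in A Q -> Q.[xs`_i] = 0 -> Q = 0.
  move=> AQ; rewrite horner_coef => Q0; apply/polyP => l; rewrite coef0.
  case: (ltnP l (size Q)) => [lQ|]; last by move/(nth_default 0).
  have Hl j : lspan (e (deg j)) (Q`_j * xs`_i ^+ j).
    have := AQ j; apply: (lspan_bind (f := fun z => z * xs`_i ^+ j)).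
      by move=> c u v; rewrite mulrDl scalerAl.
    move=> _ [be [sb b0] ->]; apply: lspan_in.
    exists (iter j (fun be => incr_nth be i) be).
      elim: (j) => [|j' [IH1 IH2]] //=; split; first by rewrite size_incr_nth IH1 ix.
      by rewrite nth_incr_nth eqxx IH2.
    rewrite mulrC; elim: (j) => [|j' IH] /=; first by rewrite expr0 mul1r.
    by rewrite mon_incr // exprS -mulrA IH.
  have E0 : Q`_l * xs`_i ^+ l = 0.
    apply: (indep_lspan_disjoint xsI (Q := deg l) (Q' := fun be => size be = n /\ nth 0%N be i != l)) => //.
    - by move=> be [].
    - by move=> be [].
    - by move=> be [_ ->] [_]; rewrite eqxx.
    - exact: Hl.
    have -> : Q`_l * xs`_i ^+ l = - \sum_(j < size Q | j != l :> nat) Q`_j * xs`_i ^+ j.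
      apply/eqP; rewrite -addr_eq0; apply/eqP.
      by move: Q0; rewrite (bigD1 (Ordinal lQ)).
    rewrite -scaleN1r; apply: lspanZ; apply: lspan_sum => j jl; move: (Hl j).
    apply: lspan_sub => _ [be [sb bj] ->]; apply: lspan_in; exists be => //.
    by split=> //; rewrite bj.
  have x0 : xs`_i != 0.
    apply/eqP => x0; pose z := incr_nth (nseq n 0%N) i.
    suff /eqP : (1 : k) = 0 by rewrite oner_eq0.
    apply: (xsI (J := [:: z]) (c := fun _ => 1) _ _ _ (mem_head _ _)) => //.
      by move=> be; rewrite inE => /eqP ->; rewrite size_incr_nth size_nseq ix.
    by rewrite big_seq1 scale1r -mon_gen.
  apply: (dom_mulI Bdom (dom_exp_neq0 Bdom l x0)); by rewrite mulrC.
(* The choice u = 0, v = 1 gives the partial derivative along x_i on k[x]. *)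
have [|d1 [Hd1 d1A d1x]] := @extend_derivation _ _ A (fun _ => 0) xs`_i 0 1 HA Hd.
  move=> Q AQ /(tr _ AQ) ->.
  by rewrite -polyC0 (thetaC _ _ _ HA Hd) ?mulr0 //; apply: subalg0.
have [s gens] := Bfg.
have HA1 := adjoin_subalg xs`_i HA.
have A1x x : x \in xs -> adjoin A xs`_i x.
  move=> /(nthP 0)[j jx <-]; have [->|ji] := eqVneq j i; first exact: adjoin_gen.
  by apply: adjoin_sub => //; apply: Ax.
have [|A2 [d2 [h [HA2 Hd2 h0 sA2 A12]]]] := @alg_extend_derivation_seq s _ d1 HA1 Hd1.
  by move=> b _; apply: alg_over_sub (xs_alg b) => a; apply: subalg_gen.
have A2T b : A2 b by apply: subalg_gen (gens b).
exists d2, h; split=> //.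
- by split=> [c u v|u v]; [apply: (Hd2.1 c) | apply: Hd2.2].
- by rewrite (A12 _ (adjoin_gen _ HA)).2 d1x mulr1.
move=> j jx ji; rewrite (A12 _ (A1x _ (mem_nth 0 jx))).2 d1A ?mul0r ?mulr0 //.
exact: Ax.
Qed.

(** Each derivation is multiplied by the values of all the others. With one common value [g], the
    weight in [wsym] depends on [al] only through its sum. *)
Lemma dual_derivations : exists g, g != 0 /\ exists f : nat -> B -> B,
  forall i, (i < size xs)%N -> [/\ is_derivation (f i), f i xs`_i = g &
    forall j, (j < size xs)%N -> j != i -> f i xs`_j = 0].
Proof.
have /choice[f /choice[h Hf]] : forall i : 'I_(size xs), exists f g,
  [/\ is_derivation f, g != 0, f xs`_i = g &
      forall j, (j < size xs)%N -> j != i :> nat -> f xs`_j = 0].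
  by move=> i; apply: dual_derivation.
exists (\prod_i h i); split; first by apply: dom_prod_neq0 => // i _; case: (Hf i).
exists (fun i => if insub i is Some j then
  mulop (\prod_(l < size xs | l != j) h l) \o f j else idfun) => i ix.
rewrite insubT; set j := Ordinal ix.
have [[fL fM] _ fx fx0] := Hf j; split.
- split; first exact: klinear_comp (klinear_mulop _) fL.
  by move=> a b; rewrite /= /mulop fM; ring.
- by rewrite /= /mulop (fx : f j xs`_i = h j) mulrC [RHS](bigD1 j).
by move=> l lx li; rewrite /= /mulop fx0 ?mulr0.
Qed.

Lemma derivation_eq0 d : is_derivation d -> (forall x, x \in xs -> d x = 0) ->
  forall b, d b = 0.
Proof.
move=> Hd dx b; apply: (derivation_alg_eq0 (gen_subalg xs) Hd) => // a.
elim=> [x /dx//||x y _ Ex _ Ey|x y _ Ex _ Ey|c x _ Ex].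
- have := Hd.2 1 1; rewrite !mulr1 mul1r => /eqP.
  by rewrite -subr_eq0 opprD addrA subrr sub0r oppr_eq0 => /eqP.
- by rewrite (klinearD Hd.1) Ex Ey addr0.
- by rewrite Hd.2 Ex Ey mul0r mulr0 addr0.
by rewrite (klinearZ Hd.1) Ex scaler0.
Qed.

End Dual.
End Derivations.

(** * Polynomial growth of the powers of a subframe *)

Lemma uniform_bound (T : eqType) (s : seq T) (P : nat -> T -> Prop) :
  (forall m m' b, (m <= m')%N -> P m b -> P m' b) ->
  (forall b, b \in s -> exists m, P m b) -> exists m, forall b, b \in s -> P m b.
Proof.
move=> mono; elim: s => [|b s IH] H; first by exists 0%N.
have [m Hm] : exists m, forall b, b \in s -> P m b.
  by apply: IH => c cs; apply: H; rewrite inE cs orbT.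
have [m' Hm'] := H b (mem_head _ _).
exists (maxn m m') => c; rewrite inE => /orP[/eqP ->|/Hm].
  by apply: mono Hm'; apply: leq_maxr.
by apply: mono; apply: leq_maxl.
Qed.

Section UpperBound.
Variables (k : fieldType) (B : comAlgType k).
Hypothesis Bdom : is_domain B.
Hypothesis char0 : [pchar k] =i pred0.
Variables xs s : seq B.
Hypothesis xs_alg : forall b, alg_over (gen_by xs) b.
Hypothesis s_gen : forall b, gen_by s b.
Implicit Types (x y b : B) (P Q : {poly B}) (d : B -> B).

Let HA := gen_subalg xs.

(** The product of the leading coefficients is a single denominator over which all elements of [r]
    become integral. Multiplying a relation by c b^e, as in [shift], brings all of them to the same
    exponent and the same denominator. *)
Lemma common_leading_coef (r : seq B) : exists E f, [/\ (0 < E)%N, f != 0, gen_by xs f &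
  forall b, b \in r -> exists Q, [/\ coefs_in (gen_by xs) Q, (size Q <= E)%N &
    f * b ^+ E = Q.[b]]].
Proof.
have shift E e f c b : gen_by xs c ->
    (exists Q, [/\ coefs_in (gen_by xs) Q, (size Q <= E)%N & f * b ^+ E = Q.[b]]) ->
    exists Q, [/\ coefs_in (gen_by xs) Q, (size Q <= E + e)%N &
      (f * c) * b ^+ (E + e) = Q.[b]].
  move=> Ac [Q [AQ sQ EQ]]; exists (c%:P * (Q * 'X^e)); split.
  - apply: (coefs_inM HA); first exact: (coefs_inC HA).
    apply: (coefs_inM HA) => // i; rewrite coefXn.
    by case: eqP => _; [apply: subalg1 | apply: subalg0].
  - rewrite mul_polyC; apply: leq_trans (size_scale_leq _ _) _.
    apply/leq_sizeP => j Hj; rewrite coefMXn.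
    case: ltnP => // ej; rewrite nth_default // (leq_trans sQ) //.
    by rewrite leq_subRL // addnC.
  by rewrite !hornerM hornerC hornerXn -EQ exprD; ring.
elim: r => [|b r [E [f [E0 f0 Af IH]]]].
  by exists 1%N, 1; split=> //; [exact: oner_neq0 | exact: gen_one].
have [P [P0 AP Pb]] := xs_alg b.
have sP : (0 < size P)%N by rewrite lt0n size_poly_eq0.
exists (E + (size P).-1)%N, (f * lead_coef P); split.
- by rewrite addn_gt0 E0.
- by apply: dom_mul_neq0; rewrite ?lead_coef_eq0.
- by apply: gen_mul => //; apply: AP.
move=> c; rewrite inE => /orP[/eqP ->|/IH]; last by apply: shift; apply: AP.
rewrite addnC (mulrC f); apply: shift => //.
exists (- take_poly (size P).-1 P); split.
- move=> i; rewrite coefN coef_take_poly -scaleN1r; apply: gen_scale.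
  by case: ifP => _; [apply: AP | apply: (subalg0 HA)].
- by rewrite size_polyN size_take_poly.
apply/eqP; rewrite hornerN -addr_eq0; apply/eqP; rewrite -[RHS]Pb [in RHS]horner_coef.
rewrite -(prednK sP) big_ord_recr /= addrC; congr (_ + _).
rewrite (@horner_coef_wide _ (size P).-1) ?size_take_poly //.
by apply: eq_bigr => i _; rewrite coef_take_poly ltn_ord.
Qed.

Lemma integral_relation : exists E f D, [/\ (0 < E)%N, f != 0, lspan (monomials xs D) f &
  forall b, b \in s -> exists a : nat -> B, (forall l, lspan (monomials xs D) (a l)) /\
    f * b ^+ E = \sum_(l < E) a l * b ^+ l].
Proof.
have le C D b : (C <= D)%N -> lspan (monomials xs C) b -> lspan (monomials xs D) b.
  by move=> CD; apply: lspan_sub => p Hp; apply: lspan_in; apply: monomials_le Hp.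
have [E [f [E0 f0 Af H]]] := common_leading_coef s.
have [Df HDf] := gen_monomials Af.
have [||D HD] := @uniform_bound _ s (fun D b => exists a : nat -> B,
    (forall l, lspan (monomials xs D) (a l)) /\ f * b ^+ E = \sum_(l < E) a l * b ^+ l).
- by move=> m m' b mm [a [Ha Ea]]; exists a; split=> // l; apply: le (Ha l).
- move=> b /H[Q [AQ sQ EQ]].
  have [||D HD] := @uniform_bound _ (Q : seq B) (fun D b => lspan (monomials xs D) b).
  + by move=> m m' c mm; apply: le.
  + by move=> c /(nthP 0)[i _ <-]; apply: gen_monomials.
  exists D, (fun l => Q`_l); split; last by rewrite EQ (horner_coef_wide _ sQ).
  move=> l; case: (ltnP l (size Q)) => lQ; first by apply: HD; apply: mem_nth.
  by rewrite nth_default //; apply: lspan0.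
exists E, f, (maxn Df D); split=> //; first by apply: le HDf; apply: leq_maxl.
move=> b /HD[a [Ha Ea]]; exists a; split=> // l; apply: le (Ha l); exact: leq_maxr.
Qed.

Fixpoint power_box (E : nat) (L r : seq B) : seq B :=
  if r is b :: r' then [seq b ^+ l * y | l <- iota 0 E, y <- power_box E L r'] else L.

Lemma size_power_box E L r : size (power_box E L r) = (E ^ size r * size L)%N.
Proof.
elim: r => [|b r IH] /=; first by rewrite expn0 mul1n.
by rewrite size_allpairs size_iota IH expnS mulnA.
Qed.

Lemma mem_power_box E L b r l y : (l < E)%N -> y \in power_box E L r ->
  b ^+ l * y \in power_box E L (b :: r).
Proof.
by move=> lE yL; apply/allpairsP; exists (l, y); rewrite mem_iota.
Qed.

Lemma power_boxP E L b r z : z \in power_box E L (b :: r) ->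
  exists l y, [/\ (l < E)%N, y \in power_box E L r & z = b ^+ l * y].
Proof.
by move=> /allpairsP[[l y] /= [lE yL ->]]; exists l, y; move: lE; rewrite mem_iota.
Qed.

Lemma monomials_box C m : monomials xs C m <-> m \in power_box C.+1 [:: 1] xs.
Proof.
elim: xs m => [|x r IH] m.
  rewrite inE; split=> [[be _ ->]//|/eqP ->]; exact: monomials1.
split.
  case=> -[|b be] [] // sb /andP[bC beC] ->; apply: mem_power_box => //.
  by apply/IH; exists be => //; split=> //; case: sb.
move=> /power_boxP[l [y [lC /IH[be [sb beC] ->] ->]]].
by exists (l :: be); rewrite //= sb -ltnS lC.
Qed.

(** * The degree filtration inside a finite k[x]-module *)

Section Degree.
Variables (E D : nat) (f : B).
Hypotheses (E0 : (0 < E)%N) (f0 : f != 0) (fD : lspan (monomials xs D) f).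
Hypothesis sE : forall b, b \in s -> exists a : nat -> B,
  (forall l, lspan (monomials xs D) (a l)) /\ f * b ^+ E = \sum_(l < E) a l * b ^+ l.

(** Exponents of the generators in [r] stay below [E] and only those of [xs] grow with [C], so the
    size is a polynomial in [C] of degree n. *)
Definition box C r := power_box E (power_box C.+1 [:: 1] xs) r.
Definition in_box C r z := lspan (fun y => y \in box C r) z.

Lemma in_box_exp C b r l y : (l < E)%N -> in_box C r y -> in_box C (b :: r) (b ^+ l * y).
Proof.
move=> lE; apply: (lspan_bind (f := fun y => b ^+ l * y)) => [c u v|z zr].
  by rewrite mulrDr scalerAr.
by apply: lspan_in; apply: mem_power_box.
Qed.

Lemma in_boxM_mon C r a z :
  lspan (monomials xs D) a -> in_box C r z -> in_box (C + D) r (a * z).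
Proof.
elim: r z => [|b r IH] z Ha Hz.
  rewrite mulrC; apply: lspanM Hz Ha => p q /monomials_box Hp Hq; apply: lspan_in.
  by apply/monomials_box; apply: monomialsM.
move: z Hz; apply: (lspan_bind (f := fun y => a * y)) => [c u v|y0].
  by rewrite mulrDr scalerAr.
move=> /power_boxP[l [y [lE yr ->]]]; rewrite mulrCA; apply: in_box_exp => //.
by apply: IH => //; apply: lspan_in.
Qed.

(** Below the exponent [E], the power of [b] goes up and [f] is absorbed as a combination of bounded
    monomials; at [E], the factor [f] is what the relation needs to bring the power down again.
    Either way the exponents of [xs] grow by at most [D]. *)
Lemma in_boxM_gen C r b z : {subset r <= s} -> b \in r -> in_box C r z ->
  in_box (C + D) r (f * b * z).
Proof.
elim: r z => // b0 r IH z rs bs.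
apply: (lspan_bind (f := fun y => f * b * y)) => [c u v|y0].
  by rewrite mulrDr scalerAr.
move=> /power_boxP[l [y [lE yr ->]]].
have By : in_box C r y by apply: lspan_in.
move: bs; rewrite inE => /orP[/eqP ->|br]; last first.
  rewrite mulrCA; apply: in_box_exp => //; apply: IH => // x xr; apply: rs.
  by rewrite inE xr orbT.
case: (ltngtP l.+1 E) => [lE'||lE'].
- rewrite (_ : _ * _ = b0 ^+ l.+1 * (f * y)); last by rewrite exprS; ring.
  by apply: in_box_exp => //; apply: in_boxM_mon.
- by rewrite ltnNge lE.
have [a [Ha Ea]] := sE (rs _ (mem_head _ _)).
rewrite (_ : _ * _ = f * b0 ^+ E * y); last by rewrite -lE' exprS; ring.
rewrite Ea mulr_suml; apply: lspan_sum => i _.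
rewrite mulrAC mulrC; apply: in_box_exp => //; exact: in_boxM_mon.
Qed.

Lemma in_box1 r : in_box 0 r 1.
Proof.
elim: r => [|b r IH]; last by rewrite -[1]mulr1 -{1}(expr0 b); apply: in_box_exp.
by apply: lspan_in; apply/monomials_box; apply: monomials1.
Qed.

Definition words (j : nat) : set B :=
  [set z | exists w : seq B, [/\ {subset w <= s}, (size w <= j)%N & z = \prod_(x <- w) x]].

(** Span of the products of at most [j] generators, the degree filtration of [B]. *)
Definition filtration j z := lspan (words j) z.

Lemma filtration_box j z : filtration j z -> in_box (j * D) s (f ^+ j * z).
Proof.
apply: (lspan_bind (f := fun y => f ^+ j * y)) => [c u v|y0].
  by rewrite mulrDr scalerAr.
move=> [w [ws wj ->]]; elim: j w ws wj => [|j IH] [|b w] //= ws wj.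
- by rewrite expr0 mul1r big_nil; apply: in_box1.
- rewrite exprS -mulrA mulSn addnC; apply: in_boxM_mon => //; exact: IH.
rewrite mulSn addnC big_cons exprS.
rewrite (_ : _ * _ = f * b * (f ^+ j * \prod_(x <- w) x)); last by ring.
apply: in_boxM_gen => //; first by apply: ws; apply: mem_head.
by apply: IH => // x xw; apply: ws; rewrite inE xw orbT.
Qed.

Lemma filtration_le j j' z : (j <= j')%N -> filtration j z -> filtration j' z.
Proof.
move=> jj; apply: lspan_sub => _ [w [ws wj ->]]; apply: lspan_in; exists w; split=> //.
exact: leq_trans jj.
Qed.

Lemma filtrationM j j' y z :
  filtration j y -> filtration j' z -> filtration (j + j') (y * z).
Proof.
apply: lspanM => _ _ [w [ws wj ->]] [w' [ws' wj' ->]]; apply: lspan_in.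
exists (w ++ w'); split; last by rewrite big_cat.
  by move=> x; rewrite mem_cat => /orP[/ws|/ws'].
by rewrite size_cat leq_add.
Qed.

Lemma filtration_ex b : exists j, filtration j b.
Proof.
elim: (s_gen b) => [x xxs||x y _ [C HC] _ [D' HD]|x y _ [C HC] _ [D' HD]|c x _ [C HC]].
- exists 1%N; apply: lspan_in; exists [:: x]; rewrite big_seq1; split=> // y.
  by rewrite inE => /eqP ->.
- by exists 0%N; apply: lspan_in; exists [::]; rewrite big_nil.
- exists (maxn C D'); apply: lspanD.
    by apply: filtration_le HC; apply: leq_maxl.
  by apply: filtration_le HD; apply: leq_maxr.
- by exists (C + D')%N; apply: filtrationM.
by exists C; apply: lspanZ.
Qed.

Definition raises c d := forall j z, filtration j z -> filtration (j + c) (d z).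

Lemma raises_le c c' d : (c <= c')%N -> raises c d -> raises c' d.
Proof.
by move=> cc Hd j z Hz; apply: filtration_le (Hd j z Hz); rewrite leq_add2l.
Qed.

(** Along a word, d(zw) = [d,z](w) + z d(w). The second term repays the loss of the letter z, and
    only the finitely many commutators with z in [s] occur in the first, so one bound serves all
    words. *)
Lemma diffop_raises m d : diffop m d -> exists c, raises c d.
Proof.
elim: m d => [|m IH] d Hd.
  case: Hd => a ->; have [c Hc] := filtration_ex a; exists c => j z Hz.
  by rewrite addnC; apply: filtrationM.
have [||c Hc] := @uniform_bound _ s (fun c z => raises c (ad z d)).
- by move=> m1 m2 b; apply: raises_le.
- by move=> z _; apply: IH; apply: (diffop_ad z Hd).
have [c1 Hc1] := filtration_ex (d 1).
have dL := diffop_klinear Hd.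
exists (maxn c c1) => j; apply: (lspan_bind (f := d)) => [//|_ [w [ws wj ->]]].
apply: (@filtration_le (size w + maxn c c1)); first by rewrite leq_add2r.
elim: w ws {wj} => [|z w IHw] ws.
  by rewrite big_nil add0n; apply: filtration_le Hc1; apply: leq_maxr.
have ws' : {subset w <= s} by move=> x xw; apply: ws; rewrite inE xw orbT.
have zs := ws z (mem_head _ _).
rewrite big_cons -[d _](subrK (z * d (\prod_(x <- w) x))); apply: lspanD.
  apply: (@filtration_le (size w + c)).
    by rewrite /= addSn ltnW // ltnS leq_add2l leq_maxl.
  by apply: (Hc z zs); apply: lspan_in; exists w.
rewrite /= addSn -add1n; apply: filtrationM; last exact: IHw.
by apply: lspan_in; exists [:: z]; rewrite big_seq1; split=> // x; rewrite inE => /eqP ->.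
Qed.

Lemma raises_ad c e x d : filtration e x -> raises c d -> raises (c + e) (ad x d).
Proof.
move=> Hx Hd j z Hz; apply: lspanB.
  by rewrite addnA addnAC; apply: Hd; rewrite addnC; apply: filtrationM.
by rewrite addnA addnC; apply: filtrationM => //; apply: Hd.
Qed.

Lemma raises_sym c e r (ys : seq B) al d : (forall x, x \in ys -> filtration e x) ->
  all (fun a => a <= r)%N al -> raises c d -> filtration (c + size ys * (r * e)) (sym ys al d).
Proof.
elim: ys al c d => [|x ys IH] al c d Hys Hal Hd.
  by rewrite addn0; apply: (Hd 0%N); apply: lspan_in; exists [::]; rewrite big_nil.
rewrite /= mulSn addnA; apply: IH.
- by move=> y yys; apply: Hys; rewrite inE yys orbT.
- by case: al Hal => //= a al /andP[].
have ha : (head 0%N al <= r)%N by case: al Hal => //= a al /andP[].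
apply: (@raises_le (c + head 0%N al * e)); first by rewrite leq_add2l leq_mul2r ha orbT.
elim: (head 0%N al) => [|a IHa]; first by rewrite addn0.
by rewrite mulSn addnCA addnC; apply: raises_ad => //; apply: Hys; apply: mem_head.
Qed.

Lemma seqpow_bound r c (V : seq (B -> B)) m d :
  (forall v, v \in V -> diffop r v /\ raises c v) ->
  d \in seqpow (fun f g => endo_comp f g) idfun V m ->
  diffop (m * r) d /\ raises (m * c) d.
Proof.
move=> HV; elim: m d => [|m IH] d /=.
  rewrite inE => /eqP ->; split; last by move=> j z; rewrite addn0.
  by exists 1; apply/funext => z; rewrite /mulop mul1r.
move=> /allpairsP[[g v] /= [/IH[g1 g2] /HV[v1 v2] ->]]; split.
  by rewrite mulSn addnC; apply: diffop_comp.
by move=> j z Hz; rewrite mulSn addnA; apply: g2; apply: v2.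
Qed.

Lemma dimspan_seqpow_le (V : seq (B -> B)) : Defs.in_alg (@DiffOps k B) V ->
  exists C, forall m,
    (dimspan (seqpow (fun f g => endo_comp f g) idfun V m) <= C * m.+1 ^ (2 * size xs))%N.
Proof.
move=> VD; pose n := size xs.
have [|v vV|r Hr] := @uniform_bound _ V (fun r v => diffop r v).
- by move=> r r' v; apply: diffop_le.
- exact: VD.
have [|v vV|c Hc] := @uniform_bound _ V (fun c v => raises c v).
- by move=> c c' v; apply: raises_le.
- by apply: diffop_raises; apply: Hr vV.
have [|x xxs|e He] := @uniform_bound _ xs (fun e x => filtration e x).
- by move=> e e' x; apply: filtration_le.
- exact: filtration_ex.
(* An element of V^m raises degrees by at most m c, and each of the n variables contributes at most
   m r commutators, each raising by [e] more; so its symbols have degree at most m times [J0]. *)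
pose J0 := (c + n * (r * e))%N.
exists (r.+1 ^ n * (E ^ size s * (J0 * D).+1 ^ n))%N => m.
pose A := {ffun 'I_n -> 'I_(m * r).+1}.
pose al (a : A) : seq nat := [seq (a i : nat) | i <- enum 'I_n].
pose psi (a : A) d := f ^+ (m * J0) * sym xs (al a) d.
apply: dimspan_leP => t tI tV.
have tm v : Defs.span t v -> diffop (m * r) v.
  move/spanE; elim=> [|z x u /tV/spanE xV _ Hu]; first exact: diffop0.
  apply: diffop_lin Hu; elim: xV => [|z' x' u' x'V _ Hu']; first exact: diffop0.
  apply: diffop_lin Hu'; apply: (seqpow_bound (c := c) _ x'V).1 => w wV.
  by split; [apply: Hr | apply: Hc].
have psiL a z u v : psi a (z *: u + v) = z *: psi a u + psi a v.
  by rewrite /psi sym_lin mulrDr scalerAr.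
apply: leq_trans (_ : #|{: A}| * size (box (m * J0 * D) s) <= _)%N.
  apply: (@lin_indep_size_le _ _ _ _ psi) => //.
    (* Symbols outside the box [A] of multi-indices vanish by [sym_neq0_le], and the power of [f]
       cancels, so joint vanishing of [psi] kills all symbols. *)
    move=> v tv psi0; apply: (sym_inj (derivation_eq0 Bdom char0 xs_alg) (tm _ tv)).
    move=> be sbe; apply: contrapT => /eqP be0.
    have lebe i : (i < n)%N -> (nth 0%N be i < (m * r).+1)%N.
      by move=> lin; rewrite ltnS; apply: (sym_neq0_le (tm _ tv) be0).
    have := psi0 [ffun i : 'I_n => Ordinal (lebe i (ltn_ord i))]; apply/eqP.
    apply: dom_mul_neq0 => //; first exact: dom_exp_neq0.
    suff -> : al [ffun i : 'I_n => Ordinal (lebe i (ltn_ord i))] = be by [].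
    rewrite /al; under eq_map => i do rewrite ffunE /=.
    rewrite (map_comp (nth 0%N be) val) val_enum_ord.
    by rewrite -[X in iota _ X]sbe -/(mkseq _ _) mkseq_nth.
  move=> a v /tV/spanE tv; apply/spanE; move: v tv.
  apply: (lspan_bind (f := psi a)) => // d dV.
  have [d1 d2] : diffop (m * r) d /\ raises (m * c) d.
    by apply: seqpow_bound dV => w wV; split; [apply: Hr | apply: Hc].
  apply: filtration_box.
  have -> : (m * J0 = m * c + size xs * (m * r * e))%N by rewrite /J0 -/n; lia.
  apply: raises_sym d2 => //.
  by apply/allP => b /mapP[i _ ->]; rewrite -ltnS.
rewrite card_ffun !card_ord !size_power_box /= muln1.
have le1 q : ((m * q).+1 <= q.+1 * m.+1)%N.
  by lia.
have -> : (m.+1 ^ (2 * size xs) = m.+1 ^ n * m.+1 ^ n)%N by rewrite mul2n -addnn expnD.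
apply: leq_trans (_ : (r.+1 * m.+1) ^ n * (E ^ size s * ((J0 * D).+1 * m.+1) ^ n) <= _)%N.
  have leX (a b q : nat) : (a <= b -> a ^ q <= b ^ q)%N.
    by move=> ab; case: q => // q; rewrite leq_exp2r.
  apply: leq_mul; first exact: leX.
  by apply: leq_mul => //; apply: leX; rewrite -mulnA.
by rewrite !expnMn; lia.
Qed.

End Degree.

Lemma growth_upper_bound (V : seq (B -> B)) : Defs.in_alg (@DiffOps k B) V ->
  exists C, forall m,
    (dimspan (seqpow (fun f g => endo_comp f g) idfun V m) <= C * m.+1 ^ (2 * size xs))%N.
Proof.
have [E [f [D [E0 f0 fD sE]]]] := integral_relation.
exact: (dimspan_seqpow_le E0 f0 fD sE).
Qed.

End UpperBound.

(** * Leading terms *)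

Section LexOrder.
Implicit Types s t u : seq nat.

Fixpoint lexlt s t : bool :=
  match s, t with
  | a :: s', b :: t' => (a < b)%N || ((a == b) && lexlt s' t')
  | _, _ => false
  end.

Lemma lexltnn s : lexlt s s = false.
Proof. by elim: s => //= a s ->; rewrite ltnn andbF. Qed.

Lemma lexlt_trans s t u : lexlt s t -> lexlt t u -> lexlt s u.
Proof.
elim: s t u => [|a s IH] [|b t] [|c u] //= /orP[ab|/andP[/eqP -> st]] /orP[bc|/andP[/eqP <- tu]].
- by rewrite (ltn_trans ab bc).
- by rewrite ab.
- by rewrite bc.
by rewrite eqxx (IH _ _ st tu) orbT.
Qed.

Lemma lexlt_total s t : size s = size t -> [|| lexlt s t, s == t | lexlt t s].
Proof.
elim: s t => [|a s IH] [|b t] //= [st]; rewrite eqseq_cons.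
by case: (ltngtP a b) => //= _; apply: IH.
Qed.

Lemma lexlt_incr s t i : size s = size t -> (i < size s)%N ->
  lexlt (incr_nth s i) (incr_nth t i) = lexlt s t.
Proof.
elim: s t i => [|a s IH] [|b t] [|i] //= [st] Hi.
by rewrite IH.
Qed.

Lemma lexlt_incr_gt s i : (i < size s)%N -> lexlt s (incr_nth s i).
Proof.
elim: s i => [|a s IH] [|i] //= Hi; first by rewrite ltnSn.
by rewrite ltnn eqxx IH.
Qed.

Lemma lexlt_cat s t s' t' : size s = size t ->
  lexlt (s ++ s') (t ++ t') = lexlt s t || ((s == t) && lexlt s' t').
Proof.
elim: s t => [|a s IH] [|b t] //= [st]; rewrite IH // eqseq_cons.
by case: (ltngtP a b).
Qed.

Lemma take_incr_nth s i n : (i < n)%N -> (n <= size s)%N ->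
  take n (incr_nth s i) = incr_nth (take n s) i /\ drop n (incr_nth s i) = drop n s.
Proof.
elim: s i n => [|a s IH] [|i] [|n] //= Hi Hn.
by have [-> ->] := IH i n Hi Hn.
Qed.

Lemma drop_incr_nth s i n : (n <= size s)%N ->
  take n (incr_nth s (n + i)) = take n s /\ drop n (incr_nth s (n + i)) = incr_nth (drop n s) i.
Proof.
elim: s n => [|a s IH] [|n] //= Hn; rewrite ?take0 ?drop0 ?add0n //.
by have [-> ->] := IH n Hn.
Qed.

Lemma incr_nth_pred s i : (0 < nth 0%N s i)%N ->
  exists t, size t = size s /\ s = incr_nth t i.
Proof.
elim: s i => [|a s IH] [|i] //=; first by case: a => // a _; exists (a :: s).
by move=> /IH[t [st Et]]; exists (a :: t); rewrite /= st -Et.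
Qed.

Lemma lex_max (J : seq (seq nat)) (P : set (seq nat)) N :
  (forall l, l \in J -> size l = N) -> (exists2 l, l \in J & P l) ->
  exists l, [/\ l \in J, P l & forall l', l' \in J -> P l' -> l' = l \/ lexlt l' l].
Proof.
elim: J => [|l J IH] sJ [l0 l0J Pl0]; first by [].
have sl := sJ l (mem_head _ _).
have sJ' l' : l' \in J -> size l' = N by move=> l'J; apply: sJ; rewrite inE l'J orbT.
have [[l1 [l1J Pl1 Hl1]]|H] := pselect (exists l, [/\ l \in J, P l &
    forall l', l' \in J -> P l' -> l' = l \/ lexlt l' l]).
  have [Pl|nPl] := pselect (P l); last first.
    exists l1; split=> //; first by rewrite inE l1J orbT.
    by move=> l'; rewrite inE => /orP[/eqP ->|/Hl1].
  have /lexlt_total/or3P[ll|/eqP ll|ll] : size l = size l1 by rewrite sl sJ'.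
  - exists l1; split=> //; first by rewrite inE l1J orbT.
    by move=> l'; rewrite inE => /orP[/eqP ->|/Hl1] //; right.
  - exists l1; split=> //; first by rewrite inE l1J orbT.
    by move=> l'; rewrite inE => /orP[/eqP ->|/Hl1] //; left.
  exists l; split=> //; first exact: mem_head.
  move=> l'; rewrite inE => /orP[/eqP ->|l'J Pl']; first by left.
  by right; case: (Hl1 _ l'J Pl') => [->//|]; move/lexlt_trans; apply.
have nJ l' : l' \in J -> ~ P l'.
  by move=> l'J Pl'; apply: H; apply: IH => //; exists l'.
move: l0J; rewrite inE => /orP[/eqP El|/nJ//]; exists l.
split; [exact: mem_head | by rewrite -El |].
by move=> l'; rewrite inE => /orP[/eqP ->|/nJ//]; left.
Qed.

Lemma box_seq n r : exists J : seq (seq nat), (forall al, al \in J -> size al = n) /\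
  forall al, size al = n -> (forall i, (i < n)%N -> (nth 0%N al i <= r)%N) -> al \in J.
Proof.
elim: n => [|n [J [sJ HJ]]].
  by exists [:: [::]]; split=> [al|[]//]; rewrite inE => /eqP ->.
exists [seq a :: b | a <- iota 0 r.+1, b <- J]; split.
  by move=> al /allpairsP[[a b] /= [_ /sJ <- ->]].
move=> [|a al] // [sal] Hal; apply/allpairsP; exists (a, al); split=> //.
  by rewrite mem_iota add0n ltnS; apply: (Hal 0%N).
by apply: HJ => // i Hi; apply: (Hal i.+1).
Qed.

End LexOrder.

(** * Elimination by leading indices, with [Fl l] for the elements strictly below [l] *)

Section Leading.
Variables (k : fieldType) (E : lmodType k) (X : set E) (N : nat).
Variables (Fl : seq nat -> set E) (Lead : E -> seq nat -> Prop).
Hypotheses (X_lin : forall c u v, X u -> X v -> X (c *: u + v))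
  (Fl0 : forall l, Fl l 0)
  (Fl_lin : forall l c u v, Fl l u -> Fl l v -> Fl l (c *: u + v))
  (Lead_size : forall w l, Lead w l -> size l = N)
  (Lead_lt : forall w l l', Lead w l -> size l' = N -> lexlt l l' -> Fl l' w)
  (Lead_notin : forall w l, Lead w l -> ~ Fl l w)
  (Lead_sub : forall w w' l, Lead w l -> Lead w' l -> exists c, Fl l (w' - c *: w))
  (Lead_ex : forall w, X w -> w != 0 -> exists l, Lead w l).

Let Fl_sum l (I : eqType) (r : seq I) (P : pred I) (F : I -> E) :
  (forall i, i \in r -> P i -> Fl l (F i)) -> Fl l (\sum_(i <- r | P i) F i).
Proof.
move=> H; rewrite big_seq_cond; apply: (big_ind (Fl l)) => //.
  by move=> u v Hu Hv; rewrite -[u]scale1r; apply: Fl_lin.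
by move=> i /andP[]; apply: H.
Qed.

Let FlZ l c u : Fl l u -> Fl l (c *: u).
Proof. by move=> Hu; rewrite -[_ *: _]addr0; apply: Fl_lin. Qed.

(** In a relation, solve for the term with the largest index: all others lie strictly below it, and
    hence so would it. *)
Lemma lead_lin_indep (J : seq (seq nat)) (y : seq nat -> E) : uniq J ->
  (forall l, l \in J -> Lead (y l) l) -> lin_indep (map y J).
Proof.
move=> UJ HJ; apply: lin_indep_map => // K c UK KJ Hc i iK.
apply: contrapT => ci.
have [|l [lK cl Hl]] := @lex_max K (fun l => c l <> 0) N _ (ex_intro2 _ _ i iK ci).
  by move=> l /KJ /HJ /Lead_size.
apply: (Lead_notin (HJ l (KJ _ lK))).
suff : Fl l (c l *: y l).
  by move=> /(FlZ (c l)^-1); rewrite scalerA mulVf ?scale1r //; apply/eqP.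
have -> : c l *: y l = - \sum_(j <- K | j != l) c j *: y j.
  by apply/eqP; rewrite -addr_eq0; apply/eqP; move: Hc; rewrite (bigD1_seq l).
rewrite -scaleN1r; apply: FlZ; apply: Fl_sum => j jK jl.
have [->|/eqP cj] := eqVneq (c j) 0; first by rewrite scale0r.
apply: FlZ; apply: (Lead_lt (HJ j (KJ _ jK))).
  by apply: (Lead_size (HJ l (KJ _ lK))).
by case: (Hl j jK cj) => // E'; rewrite E' eqxx in jl.
Qed.

(** Gaussian elimination from the top: a member with the largest leading index is kept and a
    multiple of it is subtracted from the rest, which then lies strictly below that index. The
    indices found later therefore differ from it. *)
Lemma distinct_leads (I : eqType) (J : seq I) (f : I -> E) : uniq J ->
  (forall a, a \in J -> X (f a)) -> indep_on f (fun a => a \in J) ->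
  exists f' (l : I -> seq nat), (forall a, a \in J ->
     lspan (fun z => exists2 b, b \in J & z = f b) (f' a) /\ Lead (f' a) (l a)) /\
  {in J &, injective l}.
Proof.
have [s] := ubnP (size J); elim: s J f => // s IH J f sJ UJ XJ IJ.
case EJ : J => [|i J0]; first by exists f, (fun _ => [::]); split.
have iJ : i \in J by rewrite EJ mem_head.
have f0 a : a \in J -> f a != 0.
  move=> aJ; apply/eqP => fa; have /eqP : (1 : k) = 0; last by rewrite oner_eq0.
  apply: (IJ [:: a] (fun _ => 1) _ _ _ _ (mem_head _ _)) => //.
    by move=> b; rewrite inE => /eqP ->.
  by rewrite big_seq1 fa scaler0.
have /choice[l Hl] : forall a, exists l, a \in J -> Lead (f a) l.
  move=> a; case aJ: (a \in J); last by exists [::].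
  by have [l Hl] := Lead_ex (XJ a aJ) (f0 a aJ); exists l.
have [|l0 [/mapP[a0 a0J ->] _ Hmax]] := @lex_max (map l J) (fun _ => True) N _
    (ex_intro2 _ _ (l i) (map_f l iJ) Logic.I).
  by move=> _ /mapP[a aJ ->]; apply: (Lead_size (Hl a aJ)).
have /choice[c Hc] : forall a, exists c, a \in J -> a != a0 -> Fl (l a0) (f a - c *: f a0).
  move=> a; case aJ: (a \in J); last by exists 0.
  case: (Hmax (l a) (map_f l aJ) Logic.I) => [Ela|lt].
    have La := Hl a aJ; rewrite Ela in La.
    by have [c Hc] := Lead_sub (Hl a0 a0J) La; exists c.
  exists 0 => _ _; rewrite scale0r subr0; apply: (Lead_lt (Hl a aJ)) => //.
  exact: (Lead_size (Hl a0 a0J)).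
pose J' := rem a0 J; pose f1 a := f a - c a *: f a0.
have UJ' : uniq J' by apply: rem_uniq.
have J'J a : a \in J' -> a \in J /\ a != a0.
  by rewrite /J' (rem_filter _ UJ) mem_filter => /andP[].
have [||||f' [l' [Hf' l'I]]] := IH J' f1.
- by rewrite size_rem // -ltnS prednK // EJ.
- exact: UJ'.
- move=> a /J'J[aJ _]; rewrite /f1 addrC -scaleNr; apply: X_lin; exact: XJ.
- move=> K d UK KJ' Hd a aK.
  (* A relation between the reduced members is one between the original ones; the coefficient of
     [f a0] collects what was subtracted. *)
  pose d' b := if b == a0 then - \sum_(b <- K) d b * c b else d b.
  have a0K : a0 \notin K by apply/negP => /KJ'/J'J[]; rewrite eqxx.
  have : d' a = 0.
    apply: (IJ (a0 :: K) d' _ _ _ a); last by rewrite inE aK orbT.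
    - by rewrite /= a0K.
    - by move=> b; rewrite inE => /orP[/eqP ->|/KJ'/J'J[]].
    rewrite big_cons {1}/d' eqxx -[RHS]Hd scaleNr scaler_suml -sumrN addrC.
    rewrite -big_split /=; apply: eq_big_seq => b bK.
    rewrite /d' (_ : b == a0 = false); last by apply: contraNF a0K => /eqP <-.
    by rewrite /f1 scalerBr scalerA.
  by rewrite /d' (_ : a == a0 = false) //; apply: contraNF a0K => /eqP <-.
rewrite -EJ; exists (fun a => if a == a0 then f a0 else f' a).
exists (fun a => if a == a0 then l a0 else l' a).
have inJ' a : a \in J -> (a == a0) = false -> a \in J'.
  by move=> aJ aa0; rewrite /J' (rem_filter _ UJ) mem_filter /= aJ aa0.
have l'l a : a \in J' -> l' a <> l a0.
  move=> aJ' Ela; have [Ha La] := Hf' a aJ'; apply: (Lead_notin La); rewrite Ela.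
  elim: Ha => [//|z _ v [b bJ' ->] _ IHv].
  by apply: Fl_lin => //; have [bJ ba] := J'J _ bJ'; apply: Hc.
split.
  move=> a aJ /=; case: (eqVneq a a0) => [_|/negbTE aa0].
    by split; [apply: lspan_in; exists a0 | apply: Hl].
  have [Ha La] := Hf' a (inJ' _ aJ aa0); split=> //; apply: lspan_sub Ha => _ [b bJ' ->].
  have [bJ _] := J'J _ bJ'; apply: lspanB; first by apply: lspan_in; exists b.
  by apply: lspanZ; apply: lspan_in; exists a0.
move=> a b aJ bJ.
rewrite /=; case: (eqVneq a a0) => [->|/negbTE aa0]; case: (eqVneq b a0) => [->//|/negbTE ba0] E'.
- by case: (l'l b (inJ' _ bJ ba0)).
- by case: (l'l a (inJ' _ aJ aa0)).
by apply: l'I => //; apply: inJ'.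
Qed.

End Leading.

(** * The isoperimetric subframe *)

Lemma sumn_incr_nth s i : sumn (incr_nth s i) = (sumn s).+1.
Proof.
elim: s i => [|a s IH] [|i] //=; last by rewrite IH addnS.
by elim: i => //= i ->.
Qed.

Section LowerBound.
Variables (k : fieldType) (B : comAlgType k).
Hypothesis Bdom : is_domain B.
Hypothesis char0 : [pchar k] =i pred0.
Variable xs : seq B.
Implicit Types (x y b p : B) (d w : B -> B) (u : seq B) (l al be : seq nat).
Let n := size xs.
Hypothesis xsI : indep_on (mon xs) (fun be => size be = n).
Hypothesis xs_alg : forall b, alg_over (gen_by xs) b.

Let HA := gen_subalg xs.

Definition kx_indep u := forall a : nat -> B, (forall j, gen_by xs (a j)) ->
  \sum_(j < size u) a j * u`_j = 0 -> forall j, (j < size u)%N -> a j = 0.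

Definition kx_span u b := exists a : nat -> B, (forall j, gen_by xs (a j)) /\
  b = \sum_(j < size u) a j * u`_j.

(** This replaces a basis over the fraction field of k[x]. A new t either has a nonzero multiple a t
    in the span, and a is multiplied into the denominator [p], or it is independent and joins
    [u]. *)
Lemma kx_basis (T : seq B) : exists u p, [/\ kx_indep u, gen_by xs p, p != 0 &
  forall t, t \in T -> kx_span u (p * t)].
Proof.
elim: T => [|t T [u [p [uI Ap p0 HT]]]].
  by exists [::], 1; split=> //; [exact: gen_one | exact: oner_neq0].
have [[a [Aa a0 [c [Ac Ec]]]]|H] :=
    pselect (exists a, [/\ gen_by xs a, a != 0 & kx_span u (a * t)]).
  exists u, (p * a); split=> //; first exact: gen_mul.
    exact: dom_mul_neq0.
  move=> t'; rewrite inE => /orP[/eqP ->|/HT[c' [Ac' Ec']]].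
    exists (fun j => p * c j); split=> [j|]; first exact: gen_mul.
    by rewrite -mulrA Ec mulr_sumr; apply: eq_bigr => j _; rewrite mulrA.
  exists (fun j => a * c' j); split=> [j|]; first exact: gen_mul.
  by rewrite mulrAC mulrC Ec' mulr_sumr; apply: eq_bigr => j _; rewrite mulrA.
exists (t :: u), p; split=> //.
  move=> a Aa; rewrite big_ord_recl /= => Ha.
  have a0 : a 0%N = 0.
    apply: contrapT => /eqP a0; apply: H; exists (a 0%N); split=> //.
    exists (fun j => - a j.+1); split=> [j|].
      by rewrite -scaleN1r; apply: gen_scale.
    apply/eqP; rewrite -subr_eq0 -sumrN -[X in _ == X]Ha; apply/eqP; congr (_ + _).
    by apply: eq_bigr => j _; rewrite mulNr opprK.
  move: Ha; rewrite a0 mul0r add0r => Ha [|j] //= Hj.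
  exact: (uI (fun j => a j.+1)).
move=> t'; rewrite inE => /orP[/eqP ->|/HT[c [Ac Ec]]].
  exists (fun j => if j is 0%N then p else 0); split=> [[|j]//|].
    exact: (subalg0 HA).
  by rewrite big_ord_recl /= big1 ?addr0 // => j _; rewrite mul0r.
exists (fun j => if j is j'.+1 then c j' else 0); split=> [[|j]//|].
  exact: (subalg0 HA).
by rewrite big_ord_recl /= mul0r add0r.
Qed.

Lemma gen_mon be : gen_by xs (mon xs be).
Proof.
rewrite monE; apply: (big_ind (gen_by xs)) => [||i _]; [exact: gen_one | exact: gen_mul|].
by apply: subalgX => //; apply: gen_in; apply: mem_nth.
Qed.

(** * Leading monomials over an independent family *)

Section ModuleMonomials.
Variable u : seq B.
Hypothesis uI : kx_indep u.

(** A single list holds a position in [u] followed by an exponent vector, so that the isoperimetric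
    inequality can treat both as coordinates. *)
Definition emon l : B := u`_(head 0%N l) * mon xs (behead l).
Definition evalid l : Prop := size l = n.+1 /\ (head 0%N l < size u)%N.
Definition espan (P : set (seq nat)) := lspan (fun z => exists2 l, P l & z = emon l).

(** Grouped by position in [u], a relation has coefficients in k[x]; [uI] makes these vanish, and
    then [xsI] makes their own coefficients vanish. *)
Lemma emon_indep : indep_on emon evalid.
Proof.
move=> J c UJ JV Hc l0 l0J.
pose a j := \sum_(l <- J | head 0%N l == j) c l *: mon xs (behead l).
have Aa j : gen_by xs (a j).
  by apply: subalg_sum => // l _; apply: gen_scale; apply: gen_mon.
have Ha : \sum_(j < size u) a j * u`_j = 0.
  rewrite -[RHS]Hc; under eq_bigr => j _ do rewrite mulr_suml.
  under [LHS]eq_bigr => j _ do rewrite big_mkcond.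
  rewrite exchange_big /=; apply: eq_big_seq => l lJ; have [_ lu] := JV l lJ.
  rewrite (bigD1 (Ordinal lu)) //= eqxx big1 ?addr0.
    by rewrite /emon -scalerAl mulrC.
  by move=> j jl; rewrite ifN // eq_sym.
have [sl0 l0u] := JV _ l0J.
have := uI Aa Ha l0u; rewrite /a -big_filter => E0.
pose h := head 0%N l0.
have consK l : l \in [seq l <- J | head 0%N l == h] -> h :: behead l = l.
  by rewrite mem_filter => /andP[/eqP <- /JV[]]; case: l.
have := xsI (J := [seq behead l | l <- [seq l <- J | head 0%N l == h]])
  (c := fun be => c (h :: be)) _ _ _ (i := behead l0).
have l0F : l0 \in [seq l <- J | head 0%N l == h] by rewrite mem_filter eqxx.
rewrite consK //; apply.
- rewrite map_inj_in_uniq ?filter_uniq // => l l' lF l'F E'.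
  by rewrite -(consK l lF) -(consK l' l'F) E'.
- move=> be /mapP[l]; rewrite mem_filter => /andP[_ /JV[sl _]] ->.
  by rewrite size_behead sl.
- rewrite big_map -[RHS]E0; apply: eq_big_seq => l lF; by rewrite consK.
exact: map_f.
Qed.

Lemma kx_span_espan b : kx_span u b -> espan evalid b.
Proof.
move=> [a [Aa ->]]; apply: lspan_sum => j _; have [C HC] := gen_monomials (Aa j).
move: (a j) HC; apply: (lspan_bind (f := fun y => y * u`_j)) => [c v v'|y0].
  by rewrite mulrDl scalerAl.
move=> [be [sbe _] ->]; apply: lspan_in; exists ((j : nat) :: be).
  by split; rewrite /= ?sbe.
by rewrite /emon mulrC.
Qed.

Definition elow l := espan (fun l' => evalid l' /\ lexlt l' l).
Definition elead b l := evalid l /\ exists c : k, c != 0 /\ elow l (b - c *: emon l).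

Lemma elow_trans l l' b : lexlt l l' -> elow l b -> elow l' b.
Proof.
move=> ll; apply: lspan_sub => _ [l2 [Vl2 l2l] ->]; apply: lspan_in; exists l2 => //.
by split=> //; apply: lexlt_trans ll.
Qed.

Lemma elead_low b l l' : lexlt l l' -> elead b l -> elow l' b.
Proof.
move=> ll [Vl [c [c0 Hc]]]; rewrite -[b](subrK (c *: emon l)); apply: lspanD.
  exact: elow_trans Hc.
by apply: lspanZ; apply: lspan_in; exists l.
Qed.

Lemma elead_notin b l : elead b l -> ~ elow l b.
Proof.
move=> [Vl [c [c0 Hc]]] Hb.
have He : elow l (emon l).
  rewrite -[emon l](scalerK c0); apply: lspanZ.
  by rewrite -[_ *: _](subKr b); apply: lspanB.
have e0 : emon l = 0.
  apply: (indep_lspan_disjoint emon_indep (Q := fun l' => l' = l)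
    (Q' := fun l' => evalid l' /\ lexlt l' l)) => //.
  - by move=> ? ->.
  - by move=> ? [].
  - by move=> ? -> [_]; rewrite lexltnn.
  by apply: lspan_in; exists l.
have /eqP : (1 : k) = 0; last by rewrite oner_eq0.
apply: (emon_indep (J := [:: l]) (c := fun _ => 1) _ _ _ (mem_head _ _)) => //.
  by move=> ?; rewrite inE => /eqP ->.
by rewrite big_seq1 e0 scaler0.
Qed.

Lemma elead_sub b b' l : elead b l -> elead b' l -> exists c : k, elow l (b' - c *: b).
Proof.
move=> [Vl [c [c0 Hc]]] [_ [c' [c'0 Hc']]]; exists (c' / c).
rewrite (_ : _ - _ = (b' - c' *: emon l) - (c' / c) *: (b - c *: emon l)).
  by apply: lspanB => //; apply: lspanZ.
by rewrite scalerBr scalerA divfK // opprB addrA subrK.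
Qed.

Lemma elead_ex b : espan evalid b -> b != 0 -> exists l, elead b l.
Proof.
move=> /lspan_finite[J [c [UJ JV Eb]]] b0.
have [|l [lJ cl Hl]] := @lex_max J (fun l => c l != 0) n.+1 (fun l lJ => (JV l lJ).1).
  apply: contrapT => H; case/negP: b0; rewrite Eb big_seq big1 // => l lJ.
  by have [->|cl] := eqVneq (c l) 0; [rewrite scale0r | case: H; exists l].
exists l; split; first exact: JV.
exists (c l); split=> //; rewrite Eb (bigD1_seq l) //= addrC addrK.
rewrite big_seq_cond; apply: lspan_sum => j /andP[jJ jl].
have [->|cj] := eqVneq (c j) 0; first by rewrite scale0r; apply: lspan0.
apply: lspanZ; apply: lspan_in; exists j => //; split; first exact: JV.
by case: (Hl j jJ cj) => // E'; rewrite E' eqxx in jl.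
Qed.

Lemma elead_scale (c : k) b l : c != 0 -> elead b l -> elead (c *: b) l.
Proof.
move=> c0 [Vl [c' [c'0 Hc']]]; split=> //; exists (c * c'); split; first by rewrite mulf_neq0.
by rewrite -scalerA -scalerBr; apply: lspanZ.
Qed.

Lemma emon_incr l t : evalid l -> (t < n)%N ->
  evalid (incr_nth l t.+1) /\ emon (incr_nth l t.+1) = xs`_t * emon l.
Proof.
case: l => [[]//|h l] [[sl] hu] tn; split.
  by split=> //=; rewrite size_incr_nth sl tn.
by rewrite /emon /= mon_incr // mulrCA.
Qed.

Lemma elead_incr b l t : (t < n)%N -> elead b l -> elead (xs`_t * b) (incr_nth l t.+1).
Proof.
move=> tn [Vl [c [c0 Hc]]]; have [Vl' El'] := emon_incr Vl tn.
split=> //; exists c; split=> //; rewrite El' scalerAr -mulrBr.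
move: Hc; apply: (lspan_bind (f := fun z => xs`_t * z)) => [a v v'|y0].
  by rewrite mulrDr scalerAr.
move=> [l2 [Vl2 l2l] ->]; have [Vl2' El2'] := emon_incr Vl2 tn.
apply: lspan_in; exists (incr_nth l2 t.+1) => //; split=> //.
by rewrite lexlt_incr ?(Vl.1) ?(Vl2.1).
Qed.

End ModuleMonomials.

Variables (g : B) (delta : nat -> B -> B).
Hypothesis g0 : g != 0.
Hypothesis delta_dual : forall i, (i < n)%N ->
  [/\ is_derivation (delta i), delta i xs`_i = g &
      forall j, (j < n)%N -> j != i -> delta i xs`_j = 0].

(** * Leading indices of differential operators *)

Section Symbols.
Variables (u : seq B) (p : B) (r : nat).
Hypothesis uI : kx_indep u.
Hypothesis p0 : p != 0.

(* The factor [g ^+ (r * n - sumn al)] makes left multiplication by [delta i]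
   shift leading indices without changing the leading coefficient, up to a
   positive integer. *)
Definition wsym al w := p * g ^+ (r * n - sumn al) * sym xs al w.

Definition operators : set (B -> B) := [set w | diffop r w /\
  forall al, size al = n -> espan u (evalid u) (wsym al w)].

(** Operators are compared first by the multi-index of the symbol and then by the expansion of that
    symbol, so an index list has length n + (n+1). *)
Definition olow l : set (B -> B) := [set w |
  (forall al, size al = n -> lexlt (take n l) al -> sym xs al w = 0) /\
  elow u (drop n l) (wsym (take n l) w)].

Definition olead w l := [/\ size l = (n + n.+1)%N,
  (forall al, size al = n -> lexlt (take n l) al -> sym xs al w = 0) &
  elead u (wsym (take n l) w) (drop n l)].

Lemma wsym_lin al (c : k) w w' : wsym al (c *: w + w') = c *: wsym al w + wsym al w'.
Proof. by rewrite /wsym sym_lin mulrDr scalerAr. Qed.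

Lemma wsym_eq0 al w : sym xs al w = 0 -> wsym al w = 0.
Proof. by rewrite /wsym => ->; rewrite mulr0. Qed.

Lemma operators_lin (c : k) w w' : operators w -> operators w' -> operators (c *: w + w').
Proof.
move=> [Dw Hw] [Dw' Hw']; split; first exact: diffop_lin.
by move=> al sal; rewrite wsym_lin; apply: lspanD; [apply: lspanZ; apply: Hw | apply: Hw'].
Qed.

Lemma olow0 l : olow l 0.
Proof. by split=> [al _ _|]; rewrite ?wsym_eq0 ?sym0 //; apply: lspan0. Qed.

Lemma olow_lin l (c : k) w w' : olow l w -> olow l w' -> olow l (c *: w + w').
Proof.
move=> [H1 H2] [H1' H2']; split=> [al sal lt|].
  by rewrite sym_lin H1 // H1' // scaler0 addr0.
by rewrite wsym_lin; apply: lspanD => //; apply: lspanZ.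
Qed.

Lemma olead_size w l : olead w l -> size l = (n + n.+1)%N.
Proof. by case. Qed.

Lemma olead_lt w l l' : olead w l -> size l' = (n + n.+1)%N -> lexlt l l' -> olow l' w.
Proof.
move=> [sl H1 H2] sl' ll'.
have [st st'] : size (take n l) = n /\ size (take n l') = n.
  by rewrite !size_takel ?sl ?sl' // leq_addr.
move: ll'; rewrite -{1}(cat_take_drop n l) -{1}(cat_take_drop n l').
rewrite lexlt_cat ?st ?st' // => /orP[lt|/andP[/eqP Et lt]].
  split=> [al sal lt'|]; first by apply: H1 => //; apply: lexlt_trans lt'.
  by rewrite wsym_eq0 ?H1 //; apply: lspan0.
by split; rewrite -Et //; apply: elead_low H2.
Qed.

Lemma olead_notin w l : olead w l -> ~ olow l w.
Proof. by move=> [_ _ H2] [_ H3]; apply: (elead_notin uI H2). Qed.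

Lemma olead_sub w w' l : olead w l -> olead w' l -> exists c : k, olow l (w' - c *: w).
Proof.
move=> [sl H1 H2] [_ H1' H2']; have [c Hc] := elead_sub H2 H2'; exists c.
rewrite addrC -scaleNr; split=> [al sal lt|]; first by rewrite sym_lin H1 // H1' // scaler0 addr0.
by rewrite wsym_lin scaleNr addrC.
Qed.

Lemma olead_ex w : operators w -> w != 0 -> exists l, olead w l.
Proof.
move=> [Dw Hw] w0.
have [J [sJ HJ]] := box_seq n r.
have inJ al : size al = n -> sym xs al w != 0 -> al \in J.
  by move=> sal H; apply: HJ => // i Hi; apply: (sym_neq0_le Dw H).
have [|al [alJ al0 Hal]] := @lex_max J (fun al => sym xs al w != 0) n sJ.
  apply: contrapT => H; case/negP: w0; apply/eqP.
  apply: (sym_inj (derivation_eq0 Bdom char0 xs_alg) Dw) => al sal.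
  apply: contrapT => /eqP al0; apply: H; exists al => //; exact: inJ.
have sal := sJ _ alJ.
have [|i Hi] := elead_ex (Hw al sal).
  by rewrite /wsym !dom_mul_neq0 // dom_exp_neq0.
have [Et Ed] : take n (al ++ i) = al /\ drop n (al ++ i) = i.
  by rewrite take_size_cat // drop_size_cat.
exists (al ++ i); split; rewrite ?Et ?Ed //.
  by rewrite size_cat sal; case: Hi => -[-> _].
move=> al' sal' lt; apply: contrapT => /eqP al'0.
case: (Hal al' (inJ _ sal' al'0) al'0) => [E'|lt'].
  by rewrite E' lexltnn in lt.
by have := lexlt_trans lt lt'; rewrite lexltnn.
Qed.

Lemma olead_mulop w l t : (t < n)%N -> olead w l ->
  olead (mulop xs`_t \o w) (incr_nth l (n + t.+1)).
Proof.
move=> tn [sl H1 H2]; have nl : (n <= size l)%N by rewrite sl leq_addr.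
have [Et Ed] := drop_incr_nth t.+1 nl; split; rewrite ?Et ?Ed.
- by rewrite size_incr_nth sl ltn_add2l ltnS tn.
- by move=> al sal lt; rewrite sym_mulop H1 // mulr0.
rewrite (_ : wsym _ _ = xs`_t * wsym (take n l) w); first exact: elead_incr.
by rewrite /wsym sym_mulop mulrCA.
Qed.

(** At the incremented index [sym_derivationS] leaves (al_t + 1) g times the old leading symbol, the
    other summand being [delta t] of a vanishing symbol. The weight absorbs g, and the integer is
    nonzero in characteristic zero. *)
Lemma olead_delta w l t : (t < n)%N -> operators (delta t \o w) -> olead w l ->
  olead (delta t \o w) (incr_nth l t).
Proof.
move=> tn [Dw _] [sl H1 H2]; have nl : (n <= size l)%N by rewrite sl leq_addr.
have [Et Ed] := take_incr_nth tn nl.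
have [der dg d0] := delta_dual tn.
have st : size (take n l) = n by rewrite size_takel.
have gt : lexlt (take n l) (incr_nth (take n l) t) by apply: lexlt_incr_gt; rewrite st.
have sit : size (incr_nth (take n l) t) = n by rewrite size_incr_nth st tn.
have symS al : size al = n -> sym xs (incr_nth al t) w = 0 ->
    sym xs (incr_nth al t) (delta t \o w) = (nth 0%N al t).+1%:R *: (g * sym xs al w).
  by move=> sal E0; rewrite sym_derivationS // E0 (klinear0 der.1) add0r dg.
have E0 : sym xs (incr_nth (take n l) t) w = 0 by apply: H1.
have ES := symS _ st E0.
have s0 : sym xs (take n l) w != 0.
  apply/eqP => s0; apply: (elead_notin uI H2); rewrite wsym_eq0 //; exact: lspan0.
split; rewrite ?Et ?Ed.
- by rewrite size_incr_nth sl ltn_addr.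
- move=> al sal lt.
  (* If al_t = 0, the symbol is [delta t] of a vanishing symbol of [w]. Otherwise al = al' + e_t
     with al' above the old leading index, and both summands of [sym_derivationS] vanish. *)
  have lt' := lexlt_trans gt lt.
  case: (posnP (nth 0%N al t)) => [al0|/incr_nth_pred[al' [sal' Eal]]].
    by rewrite (sym_derivation0 _ der d0) // H1 // (klinear0 der.1).
  have sal2 : size al' = n by rewrite sal' sal.
  rewrite Eal symS //; last by rewrite -Eal H1.
  rewrite H1 ?mulr0 ?scaler0 //.
  by move: lt; rewrite Eal lexlt_incr // ?st ?sal2.
(* The subtraction in the weight is truncated. The composite has order at most [r] and a nonzero
   symbol at the incremented index, so the exponent of g really drops by one, which balances the
   factor g gained. *)
have bound : (sumn (take n l) < r * n)%N.
  have nz : sym xs (incr_nth (take n l) t) (delta t \o w) != 0.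
    rewrite ES scaler_eq0 negb_or natr_neq0 //; exact: dom_mul_neq0.
  have : (sumn (incr_nth (take n l) t) <= r * n)%N.
    rewrite sumnE (big_nth 0%N) sit big_mkord mulnC -[X in (X * _)%N]card_ord -sum_nat_const.
    by apply: leq_sum => i _; apply: (sym_neq0_le Dw nz).
  by rewrite sumn_incr_nth.
rewrite (_ : wsym _ _ = (nth 0%N (take n l) t).+1%:R *: wsym (take n l) w).
  by apply: elead_scale => //; apply: natr_neq0.
rewrite /wsym ES sumn_incr_nth -scalerAr; congr (_ *: _).
by rewrite -[(r * n - sumn (take n l))%N]prednK ?subn_gt0 // -subnS exprSr; ring.
Qed.

End Symbols.

Definition weyl_frame : seq (B -> B) :=
  idfun :: [seq mulop xs`_t | t <- iota 0 n] ++ [seq delta t | t <- iota 0 n].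

Lemma weyl_frame_diffops : Defs.in_alg (@DiffOps k B) weyl_frame.
Proof.
move=> v; rewrite inE mem_cat => /or3P[/eqP ->|/mapP[t _ ->]|/mapP[t]].
- by exists 0%N, 1; apply/funext => z; rewrite /mulop mul1r.
- by exists 0%N, xs`_t.
rewrite mem_iota => /andP[_ tn] ->; exists 1%N; apply: diffop_derivation.
by case: (delta_dual tn).
Qed.

Lemma weyl_frame_expands (W : seq (B -> B)) :
  Defs.in_alg (@DiffOps k B) W -> (0 < dimspan W)%N ->
  (dimspan W ^ (2 * n).-1 <=
   (dimspan (Defs.seqprod (fun f h => endo_comp f h) weyl_frame W) - dimspan W) ^ (2 * n))%N.
Proof.
move=> HW W0; set Y := Defs.seqprod _ _ _.
have YP v w : v \in weyl_frame -> w \in W -> (v \o w) \in Y.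
  by move=> vV wW; apply/allpairsP; exists (v, w).
have YD (y : B -> B) : y \in Y -> exists m, diffop m y.
  move=> /allpairsP[[v w] /= [/weyl_frame_diffops[m Dv] /HW[m' Dw] ->]].
  by exists (m + m')%N; apply: diffop_comp.
have [|//|r Hr] := @uniform_bound _ Y (fun r v => diffop r v).
  by move=> m m' v; apply: diffop_le.
have [J [sJ HJ]] := box_seq n r.
(* These are the values of [wsym] without the factor [p], at all multi-indices where symbols of [Y]
   can be nonzero. The bound [r] is taken on [Y], not on [W], so that it also holds after
   composition with the frame. *)
pose T := [seq g ^+ (r * n - sumn al) * sym xs al y | al <- J, y : B -> B <- Y].
have [u [p [uI _ p0 HT]]] := kx_basis T.
pose X := operators u p r.
have XY (y : B -> B) : y \in Y -> X y.
  move=> yY; have Dy := Hr y yY; split=> // al sal.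
  have [s0|s0] := eqVneq (sym xs al y) 0; first by rewrite wsym_eq0 //; apply: lspan0.
  rewrite /wsym -mulrA; apply: kx_span_espan; apply: HT.
  apply/allpairsP; exists (al, y); split=> //=.
  by apply: HJ => // i Hi; apply: (sym_neq0_le Dy s0).
have XsY (y : B -> B) : lspan (fun z => z \in Y) y -> X y.
  elim=> [|c z v zY _ IH]; last by apply: operators_lin => //; apply: XY.
  split=> [|al _]; first exact: diffop0.
  by rewrite wsym_eq0 ?sym0 //; apply: lspan0.
have WY v w : v \in weyl_frame -> klinear v -> lspan (fun z => z \in W) w ->
    lspan (fun z => z \in Y) (v \o w).
  move=> vV vL; move: w; apply: (lspan_bind (f := fun w => v \o w)).
    by move=> c a b; apply/funext => z; rewrite !fctE vL.
  by move=> w wW; apply: lspan_in; apply: YP.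
have idV : idfun \in weyl_frame by apply: mem_head.
have [t [st tI tW]] := dimspan_ex W.
pose I0 := iota 0 (size t).
have tWl a : a \in I0 -> lspan (fun z => z \in W) t`_a.
  by rewrite mem_iota => /andP[_ at']; apply/spanE; apply: tW; apply: mem_nth.
have XI a : a \in I0 -> X t`_a.
  move=> aI; apply: XsY; have := WY _ _ idV _ (tWl a aI); exact.
have tI0 : indep_on (fun a => t`_a) (fun a => a \in I0).
  move=> K c UK KI; apply: (lin_indep_on tI) => // a /KI.
  by rewrite mem_iota add0n.
have [f [l [Hf lI]]] := distinct_leads (@operators_lin u p r) (@olow0 u p r)
  (@olow_lin u p r) (@olead_size u p r) (@olead_lt u p r) (@olead_notin u p r uI)
  (@olead_sub u p r) (@olead_ex u p r p0) (iota_uniq 0 (size t)) XI tI0.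
have fW a : a \in I0 -> lspan (fun z => z \in W) (f a).
  move=> aI; have [Ha _] := Hf a aI; apply: lspan_sub Ha => _ [b bI ->].
  exact: tWl.
pose S0 := [seq l a | a <- I0].
(* An index list consists of n orders, a position in [u] and n exponents; [false] marks the
   position, the only coordinate that the frame does not shift. *)
pose msk := nseq n true ++ false :: nseq n true.
pose S1 := [seq incr_nth s i | s <- S0, i <- [seq i <- iota 0 (n + n.+1) | nth false msk i]].
have US0 : uniq S0 by rewrite map_inj_in_uniq ?iota_uniq.
have size_msk : size msk = (n + n.+1)%N by rewrite size_cat /= !size_nseq.
have S0s s : s \in S0 -> size s = (n + n.+1)%N.
  by move=> /mapP[a aI ->]; have [_ /olead_size] := Hf a aI.
(* The identity in the frame gives the unshifted indices; a shift at i < n comes from [delta i], one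
   at i > n from multiplication by the variable numbered i - n - 1. *)
have lead_inY s : s \in undup (S0 ++ S1) ->
    exists y : B -> B, lspan (fun z => z \in Y) y /\ olead u p r y s.
  rewrite mem_undup mem_cat => /orP[/mapP[a aI ->]|].
    by have [_ La] := Hf a aI; exists (f a); split=> //; apply: (WY idfun) => //; apply: fW.
  move=> /allpairsP[[_ i] /= [/mapP[a aI ->]]]; rewrite mem_filter mem_iota add0n.
  move=> /andP[mi /andP[_ Hi]] ->; have [_ La] := Hf a aI; have Wa := fW a aI.
  case: (ltngtP i n) => ni.
  - have dV : delta i \in weyl_frame.
      by rewrite inE mem_cat; apply/or3P/Or33; apply: map_f; rewrite mem_iota.
    have [[dL _] _ _] := delta_dual ni; have dY := WY _ _ dV dL Wa.
    by exists (delta i \o f a); split=> //; apply: olead_delta => //; apply: XsY.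
  - have [t' Ei] : exists t', i = (n + t'.+1)%N by exists (i - n.+1)%N; rewrite addnS -addSn subnKC.
    have tn : (t' < n)%N by move: Hi; rewrite Ei ltn_add2l ltnS.
    exists (mulop xs`_t' \o f a); rewrite Ei; split; last exact: olead_mulop.
    apply: WY => //; last exact: klinear_mulop.
    by rewrite inE mem_cat; apply/or3P/Or32; apply: map_f; rewrite mem_iota.
  by move: mi; rewrite ni nth_cat size_nseq ltnn subnn.
have /choice[y Hy] : forall s, exists y : B -> B, s \in undup (S0 ++ S1) ->
    lspan (fun z => z \in Y) y /\ olead u p r y s.
  move=> s; case sS: (s \in _); last by exists 0.
  by have [y Hy] := lead_inY s sS; exists y.
have yI : lin_indep (map y (undup (S0 ++ S1))).
  apply: (lead_lin_indep (@olow0 u p r) (@olow_lin u p r) (@olead_size u p r)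
    (@olead_lt u p r) (@olead_notin u p r uI)); first exact: undup_uniq.
  by move=> s /Hy[].
have dimY : (size (undup (S0 ++ S1)) <= dimspan Y)%N.
  rewrite -(size_map y); apply: dimspan_ge => // _ /mapP[s /Hy[ys _] ->].
  exact/spanE.
have cmsk : count id msk = (2 * n)%N by rewrite count_cat /= !count_nseq /= !mul1n mul2n addnn.
have sS0 : size S0 = dimspan W by rewrite size_map size_iota.
rewrite -{1 2}sS0 -cmsk.
apply: leq_trans (isoperimetry (m := msk) (T := undup (S0 ++ S1)) US0 _ _ _ _ _) _.
- exact: undup_uniq.
- by rewrite -size_eq0 sS0 -lt0n.
- move=> s; rewrite mem_undup mem_cat size_msk => /orP[/S0s//|/allpairsP[[s' i] /= [sS0' ]]].
  rewrite mem_filter mem_iota add0n => /andP[_ /andP[_ Hi]] ->.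
  by rewrite size_incr_nth (S0s _ sS0') Hi.
- by move=> s sS; rewrite mem_undup mem_cat sS.
- move=> s i sS mi; rewrite mem_undup mem_cat; apply/orP; right.
  apply/allpairsP; exists (s, i); split=> //=; rewrite mem_filter mi mem_iota add0n /=.
  by rewrite -size_msk ltnNge; apply/negP => Hi; rewrite nth_default in mi.
by case: (count id msk) => // q; rewrite leq_exp2r // leq_sub2r.
Qed.

End LowerBound.

(** * Growth exponents *)

Section RealEstimates.
Variable R : realType.
Implicit Types (c d e q : R) (a : nat -> nat) (u : nat -> R).

Lemma limn_esup_le u q :
  (forall e, 0 < e -> exists N, forall m, (N <= m)%N -> u m <= q + e) ->
  (limn_esup (fun m => (u m)%:E) <= q%:E)%E.
Proof.
move=> H; apply/lee_addgt0Pr => e e0; have [N HN] := H e e0.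
apply: le_trans (_ : ereal_sup [set (u m)%:E | m in [set m : nat | (N <= m)%N]]%classic <= _)%E.
  by apply: ereal_inf_lbound; exists [set m : nat | (N <= m)%N]%classic => //; exists N.
by apply: ge_ereal_sup => _ [m Nm <-]; rewrite -EFinD lee_fin; apply: HN.
Qed.

Lemma limn_esup_ge u q :
  (forall e, 0 < e -> exists N, forall m, (N <= m)%N -> q - e <= u m) ->
  (q%:E <= limn_esup (fun m => (u m)%:E))%E.
Proof.
move=> H; apply: le_ereal_inf_tmp => _ [V [N0 _ N0V] <-].
apply/lee_addgt0Pr => e e0; have [N HN] := H e e0.
rewrite -leeBlDr // -EFinB.
apply: le_ereal_sup_tmp; exists (u (maxn N N0))%:E.
  by exists (maxn N N0) => //; apply: N0V; apply: leq_maxr.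
by rewrite lee_fin; apply: HN; apply: leq_maxl.
Qed.

Lemma ln_nat_ge (K : R) : exists N, forall m, (N <= m)%N -> K <= ln (m%:R : R).
Proof.
exists (Num.bound (expR K)) => m Nm.
have Km : expR K < m%:R.
  apply: lt_le_trans (_ : (Num.bound (expR K))%:R <= _); last by rewrite ler_nat.
  by apply: le_lt_trans (archi_boundP (expR_ge0 K)); apply: lexx.
have m0 : 0 < m%:R :> R by apply: lt_trans Km; apply: expR_gt0.
by rewrite -[K]expRK ler_ln ?posrE ?expR_gt0 // ltW.
Qed.

Definition growth a : \bar R :=
  limn_esup (fun m => (ln ((a m)%:R : R) / ln (m%:R : R))%:E).

Lemma growth_le a (C q : nat) : (forall m, (0 < a m)%N) ->
  (forall m, (a m <= C * m.+1 ^ q)%N) -> (growth a <= (q%:R : R)%:E)%E.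
Proof.
move=> a0 aC; have C0 : (0 < C)%N.
  by case: C aC => // /(_ 0%N); rewrite leqNgt a0.
(* For m >= 1, m + 1 <= 2m turns C (m+1)^q into D m^q. The constant then costs ln D / ln m, at most
   [e] for large m; the maximum with 1 below keeps ln m positive. *)
pose D : R := C%:R * 2 ^+ q.
have D0 : 0 < D by rewrite mulr_gt0 ?exprn_gt0 // ltr0n.
apply: limn_esup_le => e e0.
have [N HN] := ln_nat_ge (Num.max 1 (ln D / e)).
exists (maxn N 1) => m; rewrite geq_max => /andP[Nm m1].
have := HN m Nm; rewrite ge_max => /andP[lm1 lmD].
have lm0 : 0 < ln (m%:R : R) by apply: lt_le_trans lm1.
have m0 : 0 < m%:R :> R by rewrite ltr0n.
rewrite ler_pdivrMr //.
apply: le_trans (_ : ln (D * m%:R ^+ q) <= _).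
  rewrite ler_ln ?posrE ?mulr_gt0 ?exprn_gt0 ?ltr0n //.
  rewrite /D -mulrA -exprMn -!natrM -natrX -natrM ler_nat.
  apply: leq_trans (aC m) _; rewrite leq_mul2l; apply/orP; right.
  by case: (q) => // q'; rewrite leq_exp2r // mul2n -addnn -addn1 leq_add2l.
rewrite lnM ?posrE ?exprn_gt0 // lnXn // mulrDl addrC -[ln _ *+ q]mulr_natl lerD2l.
by move: lmD; rewrite ler_pdivrMr // mulrC.
Qed.

Lemma growth_ge a (kappa d : R) : 0 < kappa -> 0 < d ->
  (forall m, (1 + kappa * m%:R) `^ d <= (a m)%:R) -> (d%:E <= growth a)%E.
Proof.
move=> k0 d0 Ha; apply: limn_esup_ge => e e0.
have [N HN] := ln_nat_ge (Num.max 1 (- (d * ln kappa) / e)).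
exists (maxn N 1) => m; rewrite geq_max => /andP[Nm m1].
have := HN m Nm; rewrite ge_max => /andP[lm1 lmD].
have lm0 : 0 < ln (m%:R : R) by apply: lt_le_trans lm1.
have m0 : 0 < m%:R :> R by rewrite ltr0n.
have km : 0 < kappa * m%:R by rewrite mulr_gt0.
rewrite ler_pdivlMr //.
have am : (kappa * m%:R) `^ d <= (a m)%:R.
  apply: le_trans (Ha m); apply: ge0_ler_powR; rewrite ?ltW // ?nnegrE ?ltW //.
    by rewrite addr_gt0.
  by rewrite ltrDr.
apply: le_trans (_ : ln ((kappa * m%:R) `^ d) <= _); last first.
  by rewrite ler_ln ?posrE ?powR_gt0 // (lt_le_trans _ am) // powR_gt0.
rewrite ln_powR lnM ?posrE // mulrBl mulrDr addrC lerD2r.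
by move: lmD; rewrite ler_pdivrMr // lerNl mulrC.
Qed.

(** For T >= 1 and 0 <= w <= 1 one has (1 + wT)(1 + w) <= 1 + 3wT, so each further factor 1 + w
    costs a factor 3. The bound is crude, but linear in w. *)
Lemma powR_bernoulli (w d : R) (D : nat) : 0 <= w <= 1 -> d <= D%:R ->
  (1 + w) `^ d <= 1 + w * 3 ^+ D.
Proof.
move=> /andP[w0 w1] dD.
apply: le_trans (_ : (1 + w) `^ D%:R <= _).
  by apply: ler_powR => //; rewrite lerDl.
rewrite powR_mulrn ?addr_ge0 //; elim: D {dD} => [|D IH]; first by rewrite !expr0 lerDl mulr1.
have T1 : 1 <= 3 ^+ D :> R by rewrite exprn_ege1 // ler1n.
rewrite exprSr; apply: le_trans (_ : (1 + w * 3 ^+ D) * (1 + w) <= _).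
  by rewrite ler_wpM2r // addr_ge0.
rewrite [3 ^+ D.+1]exprS; move: (3 ^+ D) T1 => T T1.
have h1 : 0 <= w * (T - 1) by rewrite mulr_ge0 // subr_ge0.
have h2 : 0 <= w * T * (1 - w).
  by rewrite !mulr_ge0 ?subr_ge0 // (le_trans ler01).
by rewrite -subr_ge0; move: (addr_ge0 h1 h2); congr (0 <= _); ring.
Qed.

(** Discrete form of the differential inequality a' >= c a^((d-1)/d): the root Y = a^(1/d) grows by
    at least [kappa] at each step. *)
Lemma isoperimetric_growth a (c d : R) : 0 < c -> 0 < d -> (forall m, (0 < a m)%N) ->
  (forall m, (a m)%:R + c * (a m)%:R `^ ((d - 1) / d) <= (a m.+1)%:R) ->
  exists kappa, 0 < kappa /\ forall m, (1 + kappa * m%:R) `^ d <= (a m)%:R.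
Proof.
move=> c0 d0 a0 Ha; pose D := Num.bound d.
have dD : d <= D%:R by apply/ltW/archi_boundP/ltW.
have T0 : 0 < 3 ^+ D :> R by rewrite exprn_gt0.
(* [kappa <= 1] keeps kappa / Y in [0,1], where [powR_bernoulli] applies; [c / 3 ^+ D] makes its
   linear term at most the increment c A / Y. *)
pose kappa : R := Num.min 1 (c / 3 ^+ D).
have k0 : 0 < kappa by rewrite lt_min ltr01 divr_gt0.
have k1 : kappa <= 1 by rewrite ge_min lexx.
have kc : kappa * 3 ^+ D <= c by rewrite -ler_pdivlMr // ge_min lexx orbT.
exists kappa; split=> // m; elim: m => [|m IH].
  by rewrite mulr0 addr0 powR1 ler1n.
set b := 1 + kappa * m%:R in IH.
have b1 : 1 <= b by rewrite lerDl mulr_ge0 // ltW.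
pose A : R := (a m)%:R; pose Y := A `^ d^-1.
have A0 : 0 < A by rewrite ltr0n.
have Y0 : 0 < Y by apply: powR_gt0.
have YA : Y `^ d = A by rewrite -powRrM mulVf ?gt_eqF // powRr1 // ltW.
have bY : b <= Y.
  have b0 : 0 <= b by apply: le_trans b1.
  rewrite -[b](_ : (b `^ d) `^ d^-1 = b); last by rewrite -powRrM mulfV ?gt_eqF // powRr1.
  by apply: ge0_ler_powR; rewrite ?nnegrE ?invr_ge0 ?powR_ge0 // ltW.
have -> : 1 + kappa * m.+1%:R = b + kappa by rewrite /b -natr1 mulrDr mulr1 addrA.
apply: le_trans (Ha m); rewrite -/A.
have -> : A `^ ((d - 1) / d) = A / Y.
  rewrite -{1}YA -powRrM mulrCA mulfV ?gt_eqF // mulr1 powRB ?YA ?powRr1 ?(ltW Y0) //.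
  by apply/implyP => _; rewrite gt_eqF.
apply: le_trans (_ : (Y * (1 + kappa / Y)) `^ d <= _).
  apply: ge0_ler_powR; rewrite ?nnegrE ?(ltW d0) //.
  - by rewrite addr_ge0 ?(ltW k0) // (le_trans _ b1).
  - by rewrite mulr_ge0 ?(ltW Y0) // addr_ge0 // divr_ge0 // ltW.
  by rewrite mulrDr mulr1 mulrCA mulfV ?gt_eqF // mulr1 lerD2r.
have z0 : 0 <= kappa / Y by rewrite divr_ge0 // ltW.
rewrite powRM ?(ltW Y0) ?addr_ge0 // YA.
have -> : A + c * (A / Y) = A * (1 + c / Y) by rewrite mulrDr mulr1; congr (_ + _); ring.
rewrite ler_wpM2l ?(ltW A0) //; apply: le_trans (powR_bernoulli _ dD) _.
  by rewrite z0 ler_pdivrMr // mul1r (le_trans k1) // (le_trans b1).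
by rewrite lerD2l mulrAC ler_wpM2r // invr_ge0 ltW.
Qed.

End RealEstimates.

(** * The dimensions of the ring of differential operators *)

Section Powers.
Variables (k : fieldType) (B : comAlgType k).
Implicit Types (V W : seq (B -> B)) (f h : B -> B).
Let mul := fun f h : B -> B => endo_comp f h.
Let pow V m := seqpow mul idfun V m.

Lemma idfun_diffop : DiffOps (idfun : B -> B).
Proof. by exists 0%N, 1; apply/funext => z; rewrite /mulop mul1r. Qed.

Lemma seqpow_diffops V m : Defs.in_alg (@DiffOps k B) V -> Defs.in_alg (@DiffOps k B) (pow V m).
Proof.
move=> HV; elim: m => [|m IH] d /=.
  by rewrite inE => /eqP ->; apply: idfun_diffop.
move=> /allpairsP[[f h] /= [/IH[r Hf] /HV[r' Hh] ->]]; exists (r + r')%N.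
exact: diffop_comp.
Qed.

(** Powers are built by multiplying on the right, while [VDI] multiplies on the left; associativity
    reconciles the two. *)
Lemma mem_seqpowS V m f : (f \in Defs.seqprod mul V (pow V m)) = (f \in pow V m.+1).
Proof.
rewrite -[pow V m.+1]/(Defs.seqprod mul (pow V m) V).
elim: m f => [|m IH] f.
  apply/allpairsP/allpairsP => /= -[[a b] /= [aV bV ->]].
    by exists (idfun, a); split; rewrite //= ?mem_head //; move: bV; rewrite inE => /eqP ->.
  by exists (b, idfun); split; rewrite //= ?mem_head //; move: aV; rewrite inE => /eqP ->.
apply/allpairsP/allpairsP => /= -[[a b] /= [aV bV ->]].
  move: bV => /allpairsP[[b1 b2] /= [b1m b2V ->]].
  exists (mul a b1, b2); split=> //=.
  by rewrite -[_ \in _]/(mul a b1 \in Defs.seqprod mul (pow V m) V) -IH allpairs_f.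
have : a \in Defs.seqprod mul V (pow V m) by rewrite IH.
move=> /allpairsP[[a1 a2] /= [a1V a2m ->]].
by exists (a1, mul a2 b); split=> //=; apply: allpairs_f.
Qed.

Lemma dimspan_seqpowS V m : dimspan (Defs.seqprod mul V (pow V m)) = dimspan (pow V m.+1).
Proof.
apply/eqP; rewrite eqn_leq; apply/andP; split; apply: dimspan_mono => f Hf; apply: span_in.
  by rewrite -mem_seqpowS.
by rewrite mem_seqpowS.
Qed.

Lemma seqpow_sub V m f : subframe idfun (@DiffOps k B) V ->
  f \in pow V m -> Defs.span (pow V m.+1) f.
Proof.
move=> [HV /spanE V1] fm; apply/spanE.
have [r Df] := seqpow_diffops HV fm; have fL := diffop_klinear Df.
rewrite -[f]/(f \o idfun); move: (idfun : B -> B) V1.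
apply: (lspan_bind (f := fun h => f \o h)) => [c a b|h hV].
  by apply/funext => z; rewrite !fctE fL.
by apply: lspan_in; apply: (allpairs_f mul fm hV).
Qed.

Lemma dimspan_seqpow_leS V m : subframe idfun (@DiffOps k B) V ->
  (dimspan (pow V m) <= dimspan (pow V m.+1))%N.
Proof. by move=> HV; apply: dimspan_mono => f; apply: seqpow_sub. Qed.

Lemma dimspan_seqpow_gt0 V m : subframe idfun (@DiffOps k B) V -> (0 < dimspan (pow V m))%N.
Proof.
move=> HV; elim: m => [|m IH]; last exact: leq_trans IH (dimspan_seqpow_leS m HV).
apply: (dimspan_gt0 (v := idfun)); first by apply: span_in; rewrite mem_head.
by apply/eqP => /(congr1 (fun f => f 1)) /eqP; rewrite oner_eq0.
Qed.

Lemma VDI_growth (R : realType) V (d : R) : subframe idfun (@DiffOps k B) V ->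
  0 < d -> VDI mul (@DiffOps k B) V d ->
  (d%:E <= growth R (fun m => dimspan (pow V m)))%E.
Proof.
move=> HV d0 [c [c0 H]].
have [|m|kappa [k0 Hk]] := @isoperimetric_growth R (fun m => dimspan (pow V m)) c d c0 d0.
- by move=> m; apply: dimspan_seqpow_gt0.
- rewrite -dimspan_seqpowS; apply: H; last exact: dimspan_seqpow_gt0.
  by apply: seqpow_diffops; case: HV.
exact: growth_ge k0 d0 Hk.
Qed.

Lemma VDI_of_expansion (R : realType) V (q : nat) : (0 < q)%N ->
  (forall W, Defs.in_alg (@DiffOps k B) W -> (0 < dimspan W)%N ->
     (dimspan W ^ q.-1 <= (dimspan (Defs.seqprod mul V W) - dimspan W) ^ q)%N) ->
  VDI mul (@DiffOps k B) V (q%:R : R).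
Proof.
move=> q0 H; exists 1; split=> // W HW W0; rewrite mul1r.
have := H W HW W0; set w := dimspan W in W0 *; set y := dimspan _ => Hwy.
(* Otherwise the truncated difference would be 0, although w^(q-1) is positive. *)
have wy : (w <= y)%N.
  rewrite leqNgt; apply/negP => yw; move: Hwy.
  by rewrite (eqP (ltnW yw)) exp0n // leqn0 expn_eq0 eqn0Ngt W0.
have qR : (q%:R : R) != 0 by rewrite pnatr_eq0 -lt0n.
rewrite -lerBrDl -natrB //.
apply: le_trans (_ : ((y - w)%:R `^ q%:R) `^ (q%:R)^-1 <= _); last first.
  by rewrite -powRrM mulfV // powRr1.
have -> : w%:R `^ ((q%:R - 1) / q%:R) = (w%:R `^ q.-1%:R) `^ (q%:R)^-1 :> R.
  by rewrite -powRrM -subn1 natrB.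
apply: ge0_ler_powR; rewrite ?nnegrE ?invr_ge0 ?powR_ge0 //.
by rewrite !powR_mulrn // -!natrX ler_nat.
Qed.

End Powers.

Section Dimensions.
Variables (R : realType) (k : fieldType) (B : comAlgType k) (q : nat).
Let mul := fun f h : B -> B => endo_comp f h.
Hypothesis upper : forall V, Defs.in_alg (@DiffOps k B) V ->
  exists C, forall m, (dimspan (seqpow mul idfun V m) <= C * m.+1 ^ q)%N.
Hypothesis lower : exists2 V, subframe idfun (@DiffOps k B) V &
  forall W, Defs.in_alg (@DiffOps k B) W -> (0 < dimspan W)%N ->
     (dimspan W ^ q.-1 <= (dimspan (Defs.seqprod mul V W) - dimspan W) ^ q)%N.

Let growth_upper V : subframe idfun (@DiffOps k B) V ->
  (growth R (fun m => dimspan (seqpow mul idfun V m)) <= (q%:R : R)%:E)%E.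
Proof.
move=> HV; have [C HC] := upper HV.1; apply: growth_le HC => m.
exact: dimspan_seqpow_gt0.
Qed.

Lemma GK_D_eq : GK_D R B = (q%:R : R)%:E.
Proof.
apply/eqP; rewrite eq_le; apply/andP; split.
  by apply: ge_ereal_sup => _ [V HV <-]; apply: growth_upper.
have [V HV HE] := lower; apply: le_ereal_sup_tmp.
exists (growth R (fun m => dimspan (seqpow mul idfun V m))); first by exists V.
(* [VDI_growth] needs a positive exponent. For q = 0 it is enough that the quotients are
   nonnegative; for m <= 1 the denominator is 0 and so is the quotient. *)
have [q0|q0] := posnP q; last first.
  by apply: VDI_growth => //; [rewrite ltr0n | apply: VDI_of_expansion].
rewrite q0; apply: limn_esup_ge => e e0; exists 0%N => m _; rewrite sub0r.
apply: le_trans (_ : 0 <= _); first by rewrite oppr_le0 ltW.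
have ln_ge0_nat j : 0 <= ln (j%:R : R).
  by case: j => [|j]; [rewrite ln0 | apply: ln_ge0; rewrite ler1n].
by rewrite divr_ge0.
Qed.

Lemma LD_D_eq : LD_D R B = (q%:R : R)%:E.
Proof.
rewrite /LD_D /LDdim; have [q0|q0] := posnP q.
  case: asboolP => [_|[]]; first by rewrite q0.
  move=> V HV; have [C HC] := upper HV.1.
  (* For q = 0 the dimensions stay below a constant [C]. Strict growth at every step would give m <
     a m for all m, false at m = C; where growth stalls, W = V^m is the required subspace. *)
  pose a m := dimspan (seqpow mul idfun V m).
  have [m Em] : exists m, a m.+1 = a m.
    apply: contrapT => H.
    have lt m : (m < a m)%N.
      elim: m => [|m IH]; first exact: dimspan_seqpow_gt0.
      apply: leq_ltn_trans IH _; rewrite ltn_neqAle dimspan_seqpow_leS // andbT.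
      by apply/eqP => E; apply: H; exists m.
    by have := leq_trans (lt C) (HC C); rewrite q0 expn0 muln1 ltnn.
  exists (seqpow mul idfun V m); split; first by apply: seqpow_diffops; case: HV.
    exact: dimspan_seqpow_gt0.
  by rewrite dimspan_seqpowS.
have [V HV HE] := lower.
case: asboolP => [H|_].
  have [W [HW W0 EW]] := H V HV; have := HE W HW W0.
  by rewrite EW subnn exp0n // leqn0 expn_eq0 eqn0Ngt W0.
apply/eqP; rewrite eq_le; apply/andP; split.
  apply: ge_ereal_sup => _ [d [d0 [U [HU HD]]] <-].
  exact: le_trans (VDI_growth HU d0 HD) (growth_upper HU).
apply: ereal_sup_ubound; exists q%:R => //; split; first by rewrite ltr0n.
by exists V; split=> //; apply: VDI_of_expansion.
Qed.

End Dimensions.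

Theorem theorem3p4 (R : realType) (k : fieldType) (B : comAlgType k) (n : nat) :
  [pchar k] =i pred0 ->
  is_domain B ->
  finitely_generated B ->
  trdeg_eq B n ->
  LD_D R B = GK_D R B /\ LD_D R B = ((2 * n)%:R : R)%:E.
Proof.
move=> char0 Bdom Bfg trB; have [[x xI] _] := trB.
pose xs := [seq x i | i <- enum 'I_n].
have sxs : size xs = n by rewrite size_map size_enum_ord.
have xs_alg b : alg_over (gen_by xs) b by apply: trdeg_alg.
have xsI : indep_on (mon xs) (fun be => size be = size xs).
  by rewrite sxs; apply: alg_indep_mon.
have [s s_gen] := Bfg.
have [g [g0 [delta Hdelta]]] := dual_derivations Bdom char0 xsI xs_alg Bfg.
have upper V : Defs.in_alg (@DiffOps k B) V -> exists C, forall m,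
    (dimspan (seqpow (fun f h : B -> B => endo_comp f h) idfun V m) <= C * m.+1 ^ (2 * n))%N.
  by rewrite -sxs; apply: growth_upper_bound s_gen V.
have lower : exists2 V, subframe idfun (@DiffOps k B) V &
    forall W, Defs.in_alg (@DiffOps k B) W -> (0 < dimspan W)%N ->
    (dimspan W ^ (2 * n).-1 <=
     (dimspan (Defs.seqprod (fun f h : B -> B => endo_comp f h) V W) - dimspan W) ^ (2 * n))%N.
  exists (weyl_frame xs delta).
    split; first exact: weyl_frame_diffops Hdelta.
    by apply: span_in; apply: mem_head.
  by move=> W HW W0; rewrite -sxs; apply: weyl_frame_expands Hdelta W HW W0.
by rewrite (GK_D_eq R upper lower) (LD_D_eq R upper lower).
Qed.
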